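(* Let $\ell\in\mathbb{N}$ (a positive integer) and let $\mathcal{C}^{\ell}(d)$ be the constant defined recursively in the context. Then for $d>2\ell$ the inequality $$ \sum_{n\in\mathbb{Z}^d}|\Delta^{\ell/2}u(n)|^2\;\ge\;\mathcal{C}^{\ell}(d)\sum_{n\in\mathbb{Z}^d}\frac{|u(n)|^2}{|n|^{2\ell}} $$ holds for all finitely supported functions $u$ on $\mathbb{Z}^d$ with $u(0)=0$. Moreover, $$ \lim_{d\to\infty}\frac{\mathcal{C}^{\ell}(d)}{d^{\ell}}=2^{\ell}. $$
   Context: Functions $u$ on $\mathbb{Z}^d$ are complex-valued; $|n|$ is the Euclidean norm of $n\in\mathbb{Z}^d$. Since $u(0)=0$, the term $n=0$ on the right-hand side is understood to be $0$. Let $e_j$ be the $j$-th standard basis vector of $\mathbb{R}^d$. The discrete gradient and (nonnegative) discrete Laplacian are $$\nabla u(n)=(\nabla_1u(n),\dots,\nabla_du(n)),\quad \nabla_ju(n)=u(n)-u(n-e_j),\qquad \Delta u(n)=\sum_{j=1}^d\big(2u(n)-u(n-e_j)-u(n+e_j)\big).$$ Powers of the Laplacian: $\Delta^{\ell/2}u:=\Delta^{k}u$ if $\ell=2k$ is even, and $\Delta^{\ell/2}u:=\nabla(\Delta^{k}u)$ if $\ell=2k+1$ is odd; in the odd case $|\cdot|$ on the left-hand side is the Euclidean norm on $\mathbb{C}^d$. For a non-negative integer $k$ and a negative real $\beta$ put $$h_k(\beta):=-\beta^2-\frac{\beta(d-2k-2)}{2},\qquad r_k(\beta):=h_k(\beta)+\frac{k(d-2k-3)}{2}.$$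 For $\ell\ge2$ let $$\mathcal{A}^{\ell}_d:=\{(\alpha,\beta):\ \alpha<0,\ \beta<0,\ r_{\ell-2}(\alpha)>0,\ h_{\ell-1}(\beta)>0\}.$$ The constants $\mathcal{C}^{\ell}(d)$ are defined for $d>2\ell$ by recursion on $\ell$ (for such $d$ the set $\mathcal{A}^\ell_d$ is non-empty and the constants are positive and finite): $$\mathcal{C}^0(d)=1,\qquad \mathcal{C}^1(d)=2d\Big(1-\frac{\sqrt2}{\sqrt d}\Big)^2,$$ $$\text{for even }\ell\ge2:\quad \mathcal{C}^{\ell}(d)=\sup_{(\alpha,\beta)\in\mathcal{A}^{\ell}_d}\frac{4\,r_{\ell-2}(\alpha)\,h_{\ell-1}(\beta)}{\dfrac{-\alpha+\ell-1}{4\,\mathcal{C}^{\ell-2}(d)}-\beta\,\dfrac{r_{\ell-2}(\alpha)}{\mathcal{C}^{\ell-1}(d)}},$$ $$\text{for odd }\ell\ge2:\quad \mathcal{C}^{\ell}(d)=4\,\mathcal{C}^{\ell-1}(d)\sup_{(\alpha,\beta)\in\mathcal{A}^{\ell}_d}\frac{h_{\ell-1}(\beta)}{1-\beta}.$$ *)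

(* Defs.v *)
From mathcomp Require Import all_boot all_order all_algebra.
From mathcomp Require Import complex.
From mathcomp Require Import all_classical all_reals all_analysis.

Set Implicit Arguments.
Unset Strict Implicit.
Unset Printing Implicit Defensive.

Import Order.TTheory GRing.Theory Num.Theory.
Import numFieldNormedType.Exports.

Local Open Scope classical_set_scope.
Local Open Scope ring_scope.
Local Open Scope complex_scope.

(** Points of Z^d are row vectors ['rV[int]_d]; complex numbers are [R[i]]. *)

Definition stdbasis (d : nat) (j : 'I_d) : 'rV[int]_d := delta_mx 0 j.

(* Euclidean norms: [znorm] on Z^d, [cnorm] on C^d; [normc] is the
   [R]-valued modulus of a complex number. *)
Definition znorm (R : realType) (d : nat) (n : 'rV[int]_d) : R :=
  Num.sqrt (\sum_(j < d) ((n 0 j)%:~R : R) ^+ 2).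

Definition cnorm (R : realType) (d : nat) (z : 'rV[R[i]]_d) : R :=
  Num.sqrt (\sum_(j < d) Normc.normc (z 0 j) ^+ 2).

Definition dgrad (R : realType) (d : nat) (u : 'rV[int]_d -> R[i])
    (n : 'rV[int]_d) : 'rV[R[i]]_d :=
  \row_(j < d) (u n - u (n - stdbasis j)).

Definition dlaplacian (R : realType) (d : nat) (u : 'rV[int]_d -> R[i])
    (n : 'rV[int]_d) : R[i] :=
  \sum_(j < d) (u n *+ 2 - u (n - stdbasis j) - u (n + stdbasis j)).

(* |Delta^(l/2) u(n)|. The power Delta^(l/2) u is scalar-valued for even l and
   C^d-valued for odd l, so only its norm has a type independent of l. *)
Definition norm_half_lap (R : realType) (d l : nat) (u : 'rV[int]_d -> R[i])
    (n : 'rV[int]_d) : R :=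
  let v := iter l./2 (@dlaplacian R d) u in
  if odd l then cnorm (dgrad v n) else Normc.normc (v n).

Definition hfun (R : realType) (d k : nat) (b : R) : R :=
  - b ^+ 2 - b * (d%:R - 2 * k%:R - 2) / 2.

Definition rfun (R : realType) (d k : nat) (b : R) : R :=
  hfun d k b + k%:R * (d%:R - 2 * k%:R - 3) / 2.

(* Meant for [2 <= l]; the subtractions are truncated otherwise. *)
Definition admissible (R : realType) (d l : nat) : set (R * R) :=
  [set ab : R * R | [/\ ab.1 < 0, ab.2 < 0,
                        0 < rfun d (l - 2) ab.1 & 0 < hfun d (l - 1) ab.2]].

(* Meant for [2 * l < d], where every set under [sup] is non-empty and bounded
   above. *)
Fixpoint hardy_const (R : realType) (l d : nat) {struct l} : R :=
  match l with
  | 0 => 1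
  | 1 => 2 * d%:R * (1 - Num.sqrt 2 / Num.sqrt d%:R) ^+ 2
  | (l0.+1 as l1).+1 =>
      if odd l then
        4 * hardy_const R l1 d *
        sup [set hfun d (l - 1) ab.2 / (1 - ab.2)
            | ab in @admissible R d l]
      else
        sup [set 4 * rfun d (l - 2) ab.1 * hfun d (l - 1) ab.2 /
                 ((- ab.1 + l%:R - 1) / (4 * hardy_const R l0 d)
                  - ab.2 * (rfun d (l - 2) ab.1 / hardy_const R l1 d))
            | ab in @admissible R d l]
  end.

(* Main.v *)
Require Import Defs.
From mathcomp Require Import all_boot all_order all_algebra.
From mathcomp Require Import complex.
From mathcomp Require Import all_classical all_reals all_analysis.
From mathcomp Require Import ring lra zify.

Import Order.TTheory GRing.Theory Num.Theory.
Import numFieldNormedType.Exports.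

Local Open Scope classical_set_scope.
Local Open Scope ring_scope.
Local Open Scope complex_scope.

Set Implicit Arguments.
Unset Strict Implicit.
Unset Printing Implicit Defensive.

(** The inequality is proved on the Fourier side and by duality. To u corresponds
    the trigonometric polynomial f with coefficients u(n), to Delta the
    multiplication by w(x) = sum_j (2 - 2 cos x_j), and to the multiplication by
    |n|^2 of the coefficients the operator - Laplacian of the torus. Put
    psi_n = u(n) / |n|^(2l), so that f = (- Laplacian)^l psi, and write S for the
    right-hand sum without its constant C. Then S is the scalar product of f and
    psi, and 2 C f psi <= w^l |f|^2 + C^2 w^(-l) |psi|^2, so C S <= int w^l |f|^2
    as soon as the torus inequality

      C int w^(-l) |psi|^2 <= sum_n |n|^(2l) |psi_n|^2        (psi_0 = 0)

    holds (predicate [torus_hardy]). It is proved by induction on l. Expanding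
    the square of grad psi - b psi (grad w) / w, with |grad w|^2 <= 4 w and
    Laplacian w = 2 d - w, gives for b <= 0 ([weighted_hardy])

      4 h_k(b) int w^(-k-1) |psi|^2
        <= int w^(-k) |grad psi|^2 - b int w^(-k) |psi|^2,

    and an integration by parts that compares the Hessian with the Laplacian
    turns the same inequality, applied to the partial derivatives of psi, into
    ([weighted_rellich])

      4 r_k(a) int w^(-k-1) |grad psi|^2
        <= int w^(-k) |Laplacian psi|^2 + (k - a) int w^(-k) |grad psi|^2.

    The right-hand sides are bounded by the torus inequalities for smaller
    exponents, applied to psi, to its partial derivatives and to its Laplacian;
    |n| >= 1 away from the origin serves as the Poincare inequality. Optimizing
    over a and b yields exactly the recursion of the constants.

    No integral is computed. An inequality between integrals is replaced by a
    pointwise inequality up to the divergence of a bounded vector field and an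
    arbitrarily small error ([mean_le]); all steps above are integrations by
    parts, Parseval's identity included, since cos((n - m).x) with n <> m is a
    partial derivative. The only passage back to numbers is [mean_le_cst]: a
    constant bounded above by divergences of bounded fields is not positive. The
    weight w is replaced by w + e with e > 0 so that its inverse is smooth, and e
    tends to 0 at the very end.

    For the limit, no admissible pair yields more than 2 d C^l, because
    h_k(b) <= - b d / 2, so C^(l+1) <= 2 d C^l; conversely the choice
    a = -1, b = - sqrt d gives C^(l+1) >= C^l d (2 - o(1)). The ratios
    C^l / d^l are thus squeezed to 2^l. *)

(** * Quantitative partial derivatives and divergences of bounded fields *)

Section PartialDerivatives.
Variables (R : realType) (d : nat).
Implicit Types (x : 'rV[R]_d) (G H : 'rV[R]_d -> R) (j : 'I_d).

Definition step j (h : R) x : 'rV[R]_d := x + h *: delta_mx 0 j.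

(** A first-order expansion with a uniform quadratic remainder. Unlike mere
    differentiability it is stable under averaging with the same constant, and
    it controls a telescoping sum on a grid without any mean value theorem. *)
Definition expands j (K : R) G G' : Prop :=
  [/\ forall x, `|G x| <= K, forall x, `|G' x| <= K &
      forall x h, `|h| <= 1 ->
        `|G (step j h x) - G x - h * G' x| <= K * h ^+ 2].

Definition has_partial j G G' : Prop := exists K, expands j K G G'.

Lemma expandsW j K L G G' : K <= L -> expands j K G G' -> expands j L G G'.
Proof.
move=> KL [g0 g1 g2]; split => [x|x|x h h1].
- exact: le_trans (g0 x) KL.
- exact: le_trans (g1 x) KL.
- by apply: le_trans (g2 x h h1) _; rewrite ler_wpM2r ?sqr_ge0.
Qed.

Lemma expands_ge0 j K G G' : expands j K G G' -> 0 <= K.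
Proof. by case=> g0 _ _; apply: le_trans (normr_ge0 _) (g0 0). Qed.

Lemma has_partial2 j G G' H H' : has_partial j G G' -> has_partial j H H' ->
  exists K, [/\ 0 <= K, expands j K G G' & expands j K H H'].
Proof.
move=> [K gK] [L hL]; exists (Num.max K L); split.
- by rewrite le_max (expands_ge0 gK).
- by apply: expandsW gK; rewrite le_max lexx.
- by apply: expandsW hL; rewrite le_max lexx orbT.
Qed.

Lemma has_partial_eq j G G' H H' :
  G =1 H -> G' =1 H' -> has_partial j G G' -> has_partial j H H'.
Proof.
by move=> /funext -> /funext ->.
Qed.

Lemma has_partial_cst j (c : R) : has_partial j (fun=> c) (fun=> 0).
Proof.
exists `|c|; split=> [x|x|x h h1]; rewrite ?normr0//.
by rewrite mulr0 subrr subr0 normr0 mulr_ge0 ?sqr_ge0.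
Qed.

Lemma has_partialD j G G' H H' : has_partial j G G' -> has_partial j H H' ->
  has_partial j (fun x => G x + H x) (fun x => G' x + H' x).
Proof.
move=> gp hp; have [K [K0 [g0 g1 g2] [h0 h1 h2]]] := has_partial2 gp hp.
exists (K + K); split=> [x|x|x t t1].
- exact: le_trans (ler_normD _ _) (lerD (g0 x) (h0 x)).
- exact: le_trans (ler_normD _ _) (lerD (g1 x) (h1 x)).
- rewrite (_ : _ - _ = (G (step j t x) - G x - t * G' x) +
                       (H (step j t x) - H x - t * H' x)); last by ring.
  by rewrite mulrDl; apply: le_trans (ler_normD _ _) (lerD (g2 _ _ t1) (h2 _ _ t1)).
Qed.

Lemma has_partialM j G G' H H' : has_partial j G G' -> has_partial j H H' ->
  has_partial j (fun x => G x * H x) (fun x => G' x * H x + G x * H' x).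
Proof.
move=> gp hp; have [K [K0 [g0 g1 g2] [h0 h1 h2]]] := has_partial2 gp hp.
have KK0 : 0 <= K * K by rewrite mulr_ge0.
exists (4 * (K * K)); split=> [x|x|x t t1].
- rewrite normrM; have := ler_pM (normr_ge0 _) (normr_ge0 _) (g0 x) (h0 x).
  by move=> ?; lra.
- apply: le_trans (ler_normD _ _) _; rewrite !normrM.
  have := ler_pM (normr_ge0 _) (normr_ge0 _) (g0 x) (h1 x).
  by have := ler_pM (normr_ge0 _) (normr_ge0 _) (g1 x) (h0 x) => *; lra.
- set y := step j t x.
  rewrite (_ : _ - _ = G y * (H y - H x - t * H' x) +
     H x * (G y - G x - t * G' x) +
     (t * H' x * (G y - G x - t * G' x) + t ^+ 2 * (G' x * H' x))); last by ring.
  apply: le_trans (ler_normD _ _) _.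
  have -> : 4 * (K * K) * t ^+ 2 = (K * (K * t ^+ 2) + K * (K * t ^+ 2)) +
     (1 * K * (K * t ^+ 2) + t ^+ 2 * (K * K)) by ring.
  have tt0 := sqr_ge0 t.
  apply: lerD; apply: le_trans (ler_normD _ _) _; apply: lerD;
    rewrite !normrM.
  + exact: ler_pM (h2 _ _ t1).
  + exact: ler_pM (g2 _ _ t1).
  + by apply: ler_pM => //; [exact: ler_pM | exact: g2].
  + rewrite -expr2 real_normK ?num_real// ler_wpM2l//.
    exact: ler_pM.
Qed.

Lemma has_partialZ j (c : R) G G' : has_partial j G G' ->
  has_partial j (fun x => c * G x) (fun x => c * G' x).
Proof.
move=> gp; apply: has_partial_eq (has_partialM (has_partial_cst j c) gp) => // x.
by rewrite mul0r add0r.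
Qed.

Lemma has_partial_sum (I : Type) (s : seq I) (F F' : I -> 'rV[R]_d -> R) j :
  (forall i, has_partial j (F i) (F' i)) ->
  has_partial j (fun x => \sum_(i <- s) F i x) (fun x => \sum_(i <- s) F' i x).
Proof.
move=> FF'; elim: s => [|i s ihs].
  by apply: has_partial_eq (has_partial_cst j 0) => x; rewrite big_nil.
by apply: has_partial_eq (has_partialD (FF' i) ihs) => x; rewrite big_cons.
Qed.

(** The lower bound on G is what makes the remainder of its inverse uniform. *)
Lemma has_partialV j (e : R) G G' : 0 < e -> (forall x, e <= G x) ->
  has_partial j G G' ->
  has_partial j (fun x => (G x)^-1) (fun x => - (G x)^-1 ^+ 2 * G' x).
Proof.
move=> e0 eG [K gK]; have K0 := expands_ge0 gK.
have G0 x : 0 < G x := lt_le_trans e0 (eG x).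
pose L := e^-1; have L0 : 0 < L by rewrite invr_gt0.
have GL x : (G x)^-1 <= L by rewrite lef_pV2 ?posrE.
have GV0 x : 0 <= (G x)^-1 by rewrite invr_ge0 ltW.
case: gK => [g0 g1 g2].
have GL2 x : (G x)^-1 ^+ 2 <= L ^+ 2 by rewrite lerXn2r ?nnegrE// ltW.
have LK0 : 0 <= L ^+ 2 * K by rewrite mulr_ge0// sqr_ge0.
have LK1 : 0 <= 3 * L ^+ 3 * K ^+ 2
  by rewrite mulr_ge0 ?sqr_ge0// mulr_ge0// exprn_ge0// ltW.
exists (L + L ^+ 2 * K + 3 * L ^+ 3 * K ^+ 2); split=> [x|x|x t t1].
- by rewrite ger0_norm//; have ? := GL x; lra.
- rewrite normrM normrN (ger0_norm (sqr_ge0 _)).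
  apply: le_trans (ler_pM (sqr_ge0 _) (normr_ge0 _) (GL2 x) (g1 x)) _; lra.
- set y := step j t x.
  have Gx := G0 x; have Gy := G0 y.
  rewrite (_ : _ - _ = (G x)^-1 ^+ 2 * (G y)^-1 *
     (- G x * (G y - G x - t * G' x) + t * G' x * (G y - G x - t * G' x)
       + t ^+ 2 * G' x ^+ 2)); last by field; rewrite !gt_eqF.
  have tt0 := sqr_ge0 t.
  rewrite normrM [X in X * _]ger0_norm; last by rewrite mulr_ge0 ?sqr_ge0.
  apply: (@le_trans _ _ (L ^+ 2 * L * (K * (K * t ^+ 2) + 1 * K * (K * t ^+ 2) +
      t ^+ 2 * K ^+ 2))).
    apply: ler_pM => //; first by rewrite mulr_ge0 ?sqr_ge0.
      by rewrite ler_pM ?sqr_ge0.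
    apply: le_trans (ler_normD _ _) _; apply: lerD; last first.
      rewrite ger0_norm; last by apply: mulr_ge0 => //; exact: sqr_ge0.
      apply: ler_wpM2l => //.
      by rewrite -[G' x ^+ 2]real_normK ?num_real// lerXn2r ?nnegrE.
    apply: le_trans (ler_normD _ _) _; rewrite !normrM normrN.
    apply: lerD; first exact: ler_pM (g2 _ _ t1).
    by apply: ler_pM => //; [exact: ler_pM | exact: g2].
  have -> : L ^+ 2 * L * (K * (K * t ^+ 2) + 1 * K * (K * t ^+ 2) +
      t ^+ 2 * K ^+ 2) = 3 * L ^+ 3 * K ^+ 2 * t ^+ 2 by ring.
  by rewrite ler_wpM2r//; lra.
Qed.

End PartialDerivatives.

Section Divergences.
Variables (R : realType) (d : nat).
Implicit Types (x : 'rV[R]_d) (G H g : 'rV[R]_d -> R) (j : 'I_d).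

(** Mean over M translates with step h in the direction j; [box_avg] iterates it
    over a list of directions, hence averages over a grid. *)
Definition avg (M : nat) (h : R) j G x : R :=
  M%:R^-1 * \sum_(i < M) G (step j (i%:R * h) x).

Definition box_avg (M : nat) (h : R) (r : seq 'I_d) G : 'rV[R]_d -> R :=
  foldl (fun F j => avg M h j F) G r.

Lemma avg_le M h j G (c : R) : (0 < M)%N ->
  (forall x, G x <= c) -> forall x, avg M h j G x <= c.
Proof.
move=> M0 Gc x; rewrite /avg ler_pdivrMl ?ltr0n//.
apply: le_trans (ler_sum _ (fun i _ => Gc _)) _.
by rewrite sumr_const card_ord mulr_natl.
Qed.

Lemma box_avg_le M h r G (c : R) : (0 < M)%N ->
  (forall x, G x <= c) -> forall x, box_avg M h r G x <= c.
Proof.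
move=> M0; elim: r G => //= j r ihr G Gc; apply: ihr.
exact: avg_le.
Qed.

Lemma box_avg_ge M h r G (c : R) : (0 < M)%N ->
  (forall x, c <= G x) -> forall x, c <= box_avg M h r G x.
Proof.
move=> M0; elim: r G => //= j r ihr G Gc; apply: ihr => x.
rewrite /avg ler_pdivlMl ?ltr0n//.
apply: le_trans (ler_sum _ (fun i _ => Gc _)).
by rewrite sumr_const card_ord mulr_natl.
Qed.

Lemma box_avgD M h r G H x :
  box_avg M h r (fun x => G x + H x) x = box_avg M h r G x + box_avg M h r H x.
Proof.
elim: r G H => //= j r ihr G H; rewrite -ihr; congr box_avg.
by apply/funext => y; rewrite /avg big_split mulrDr.
Qed.

Lemma box_avg0 M h r x : box_avg M h r (fun=> 0) x = 0.
Proof.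
elim: r => //= j r ihr; rewrite -[RHS]ihr; congr box_avg.
by apply/funext => y; rewrite /avg big1 ?mulr0.
Qed.

Lemma box_avg_sum M h r (I : Type) (s : seq I) (F : I -> 'rV[R]_d -> R) x :
  box_avg M h r (fun x => \sum_(i <- s) F i x) x =
  \sum_(i <- s) box_avg M h r (F i) x.
Proof.
elim: s => [|i s ihs].
  rewrite big_nil -[RHS](box_avg0 M h r x); congr box_avg.
  by apply/funext => y; rewrite big_nil.
rewrite big_cons -ihs -box_avgD; congr box_avg.
by apply/funext => y; rewrite big_cons.
Qed.

Lemma stepC i j (s t : R) x : step i s (step j t x) = step j t (step i s x).
Proof. by rewrite /step addrAC. Qed.

Lemma stepD j (s t : R) x : step j s (step j t x) = step j (t + s) x.
Proof. by rewrite /step -addrA -scalerDl. Qed.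

Lemma expands_avg M h i j K G G' : (0 < M)%N -> expands j K G G' ->
  expands j K (avg M h i G) (avg M h i G').
Proof.
move=> M0 [g0 g1 g2].
have avg_norm (F : 'I_M -> R) (c : R) : (forall k, `|F k| <= c) ->
    `|M%:R^-1 * \sum_(k < M) F k| <= c.
  move=> Fc; rewrite normrM ger0_norm ?invr_ge0// ler_pdivrMl ?ltr0n//.
  apply: le_trans (ler_norm_sum _ _ _) _.
  apply: le_trans (ler_sum _ (fun k _ => Fc k)) _.
  by rewrite sumr_const card_ord mulr_natl.
split=> [x|x|x t t1]; [exact: avg_norm|exact: avg_norm|].
rewrite /avg [t * _]mulrCA [t * \sum_(_ < _) _]mulr_sumr -!mulrBr -!sumrB.
by apply: avg_norm => k; rewrite stepC; exact: g2.
Qed.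

(** The sum of h G' over the grid is a telescoping sum of G, up to M remainders of
    size K h^2. *)
Lemma avg_partial_le M h j K G G' : (0 < M)%N -> 0 < h <= 1 ->
  expands j K G G' -> forall x, avg M h j G' x <= 2 * K / (M%:R * h) + K * h.
Proof.
move=> M0 /andP[h0 h1] [g0 g1 g2] x.
have M0' : 0 < M%:R :> R by rewrite ltr0n.
have hG i : h * G' (step j (i%:R * h) x) <=
    G (step j (i.+1%:R * h) x) - G (step j (i%:R * h) x) + K * h ^+ 2.
  have := g2 (step j (i%:R * h) x) h; rewrite (ger0_norm (ltW h0)) => /(_ h1).
  have -> : step j h (step j (i%:R * h) x) = step j (i.+1%:R * h) x.
    by rewrite stepD -natr1 mulrDl mul1r.
  by rewrite ler_norml => /andP[? ?]; lra.
rewrite /avg ler_pdivrMl// -(ler_pM2l h0) mulr_sumr.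
apply: le_trans (ler_sum _ (fun (i : 'I_M) _ => hG i)) _.
rewrite big_split/= sumr_const card_ord -(big_mkord xpredT
  (fun i => G (step j (i.+1%:R * h) x) - G (step j (i%:R * h) x))).
rewrite (telescope_sumr (fun i : nat => G (step j (i%:R * h) x)))//.
have -> : h * (M%:R * (2 * K / (M%:R * h) + K * h)) = 2 * K + M%:R * (K * h ^+ 2).
  by field; rewrite !gt_eqF.
rewrite -[K * h ^+ 2 *+ M]mulr_natl lerD2r.
have := g0 (step j (M%:R * h) x); have := g0 (step j (0 * h) x).
by rewrite !ler_norml => /andP[? ?] /andP[? ?]; lra.
Qed.

(** Averages in the directions other than j preserve [expands], so that the
    one-dimensional estimate applies once the direction j is reached. *)
Lemma box_avg_partial_le M h r j K G G' : (0 < M)%N -> 0 < h <= 1 -> j \in r ->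
  expands j K G G' ->
  forall x, box_avg M h r G' x <= 2 * K / (M%:R * h) + K * h.
Proof.
move=> M0 h01; elim: r G G' => //= i r ihr G G' + GG'.
have [ji _|ij] := eqVneq j i; last first.
  by rewrite in_cons (negbTE ij) => jr; apply: ihr => //; exact: expands_avg GG'.
by rewrite -ji; apply: box_avg_le => //; exact: avg_partial_le GG'.
Qed.

(** Averaging over a box of side P with mesh 1/P bounds the mean of a divergence
    by a multiple of 1/P: the boundary terms and the discretization errors are
    both of that order. *)
Lemma divergence_bound_le0 (G G' : 'I_d -> 'rV[R]_d -> R) (c : R) :
  (forall j, has_partial j (G j) (G' j)) ->
  (forall x, c <= \sum_j G' j x) -> c <= 0.
Proof.
move=> /choice[K GG'] cG.
pose S := \sum_j K j.
have KS j : 0 <= K j by exact: expands_ge0 (GG' j).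
have S0 : 0 <= S by apply: sumr_ge0.
have cP (P : nat) : (0 < P)%N -> c <= 3 * S / P%:R.
  move=> P0; have P0' : 0 < P%:R :> R by rewrite ltr0n.
  have PP0 : (0 < P * P)%N by rewrite muln_gt0 P0.
  have h01 : 0 < (P%:R^-1 : R) <= 1.
    by rewrite invr_gt0 P0' invf_le1// ler1n.
  have : c <= box_avg (P * P) P%:R^-1 (enum 'I_d) (fun x => \sum_j G' j x) 0.
    exact: box_avg_ge.
  rewrite box_avg_sum => /le_trans; apply.
  have -> : 3 * S / P%:R = \sum_j 3 * K j / P%:R by rewrite -mulr_suml -mulr_sumr.
  apply: ler_sum => j _.
  apply: le_trans (box_avg_partial_le PP0 h01 _ (GG' j) 0) _.
    by rewrite mem_enum.
  rewrite natrM le_eqVlt; apply/orP; left; apply/eqP.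
  by field; rewrite gt_eqF.
rewrite leNgt; apply/negP => c0.
pose P := Num.truncn (3 * S / c).
have := cP P.+1 isT; rewrite ler_pdivlMr ?ltr0n// mulrC -ler_pdivlMr//.
have := Num.Theory.truncnS_gt (3 * S / c).
by rewrite -/P ltNge => /negP.
Qed.

End Divergences.

(** * Inequalities between means *)

Section MeanOrder.
Variables (R : realType) (d : nat).
Implicit Types (x : 'rV[R]_d) (f g h : 'rV[R]_d -> R) (j : 'I_d).

(** The mean of f is at most that of g, witnessed by a field whose divergence
    accounts for the difference. The error e makes the relation closed under
    suprema of constants, see [mean_le_sup]. *)
Definition mean_le f g : Prop := forall e, 0 < e ->
  exists F F' : 'I_d -> 'rV[R]_d -> R,
    (forall j, has_partial j (F j) (F' j)) /\
    (forall x, f x <= g x + \sum_j F' j x + e).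

Lemma mean_leW f g : (forall x, f x <= g x) -> mean_le f g.
Proof.
move=> fg e e0; exists (fun _ _ => 0), (fun _ _ => 0); split=> [j|x].
  exact: has_partial_cst.
by rewrite big1// addr0; apply: le_trans (fg x) _; rewrite lerDl ltW.
Qed.

Lemma mean_le_trans g f h : mean_le f g -> mean_le g h -> mean_le f h.
Proof.
move=> fg gh e e0; have e20 : 0 < e / 2 by rewrite divr_gt0.
have [F [F' [FF' Fle]]] := fg _ e20; have [G [G' [GG' Gle]]] := gh _ e20.
exists (fun j x => F j x + G j x), (fun j x => F' j x + G' j x); split=> [j|x].
  exact: has_partialD.
by rewrite big_split/=; have := Fle x; have := Gle x => *; lra.
Qed.

Lemma mean_leD f g f' g' : mean_le f g -> mean_le f' g' ->
  mean_le (fun x => f x + f' x) (fun x => g x + g' x).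
Proof.
move=> fg gh e e0; have e20 : 0 < e / 2 by rewrite divr_gt0.
have [F [F' [FF' Fle]]] := fg _ e20; have [G [G' [GG' Gle]]] := gh _ e20.
exists (fun j x => F j x + G j x), (fun j x => F' j x + G' j x); split=> [j|x].
  exact: has_partialD.
by rewrite big_split/=; have := Fle x; have := Gle x => *; lra.
Qed.

Lemma mean_leZ (c : R) f g : 0 <= c -> mean_le f g ->
  mean_le (fun x => c * f x) (fun x => c * g x).
Proof.
rewrite le_eqVlt => /predU1P[<- _|c0 fg e e0].
  by apply: mean_leW => x; rewrite !mul0r.
have [F [F' [FF' Fle]]] := fg _ (divr_gt0 e0 c0).
exists (fun j x => c * F j x), (fun j x => c * F' j x); split=> [j|x].
  exact: has_partialZ.
rewrite -mulr_sumr (_ : e = c * (e / c)); last by rewrite mulrC divfK ?gt_eqF.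
by rewrite -!mulrDr ler_pM2l.
Qed.

Lemma mean_le_sum (I : Type) (s : seq I) (f g : I -> 'rV[R]_d -> R) :
  (forall i, mean_le (f i) (g i)) ->
  mean_le (fun x => \sum_(i <- s) f i x) (fun x => \sum_(i <- s) g i x).
Proof.
move=> fg; elim: s => [|i s ihs].
  by apply: mean_leW => x; rewrite !big_nil.
have := mean_leD (fg i) ihs; congr mean_le; apply/funext => x; by rewrite big_cons.
Qed.

Lemma mean_le_divergence f g (F F' : 'I_d -> 'rV[R]_d -> R) :
  (forall j, has_partial j (F j) (F' j)) ->
  (forall x, f x <= g x + \sum_j F' j x) -> mean_le f g.
Proof.
move=> FF' fg e e0; exists F, F'; split=> // x.
by apply: le_trans (fg x) _; rewrite lerDl ltW.
Qed.

Lemma mean_le_partial j f g F F' : has_partial j F F' ->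
  (forall x, f x <= g x + F' x) -> mean_le f g.
Proof.
move=> FF' fg.
apply: (@mean_le_divergence _ _ (fun i x => (i == j)%:R * F x)
  (fun i x => (i == j)%:R * F' x)) => [i|x].
  have [->|_] := eqVneq i j; first exact: has_partialZ.
  by apply: has_partial_eq (has_partial_cst i 0) => x; rewrite mul0r.
rewrite (bigD1 j)//= eqxx mul1r big1 ?addr0// => i /negPf ->.
by rewrite mul0r.
Qed.

Lemma mean_le_cst (a b : R) : mean_le (fun=> a) (fun=> b) -> a <= b.
Proof.
move=> ab; apply/ler_addgt0Pr => e e0.
have [F [F' [FF' Fle]]] := ab _ e0.
rewrite -subr_le0; apply: (divergence_bound_le0 FF') => x.
by have := Fle x => *; lra.
Qed.

(** An inequality between means depends only on the difference of its sides; this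
    is how linear combinations of known inequalities are turned into a new one. *)
Lemma mean_le_shift f g f' g' : mean_le f g ->
  (forall x, f' x - g' x <= f x - g x) -> mean_le f' g'.
Proof.
move=> fg le e e0; have [F [F' [FF' Fle]]] := fg _ e0.
exists F, F'; split=> // x.
by have := Fle x; have := le x => *; lra.
Qed.

Lemma mean_le_sup (E : set R) f g (K : R) : has_sup E ->
  (forall x, 0 <= f x <= K) ->
  (forall c, E c -> mean_le (fun x => c * f x) g) ->
  mean_le (fun x => sup E * f x) g.
Proof.
move=> Esup fK cfg e e0.
have K0 : 0 < `|K| + 1 by rewrite ltr_wpDl.
have e20 : 0 < e / 2 by rewrite divr_gt0.
have [c Ec cE] := sup_adherent (divr_gt0 e20 K0) Esup.
have [F [F' [FF' Fle]]] := cfg c Ec _ e20.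
exists F, F'; split=> // x.
have : (sup E - c) * f x <= e / 2 / (`|K| + 1) * (`|K| + 1).
  have /andP[f0 fK'] := fK x.
  apply: (@le_trans _ _ (e / 2 / (`|K| + 1) * f x)).
    by rewrite ler_wpM2r//; lra.
  rewrite ler_wpM2l ?divr_ge0 ?ltW//.
  by have := ler_norm K => *; lra.
rewrite divfK ?gt_eqF// mulrBl => ?.
by have := Fle x => *; lra.
Qed.

End MeanOrder.

(** * The symbol of the Laplacian and the weighted Hardy inequality *)

Section Symbol.
Variables (R : realType) (d : nat).
Implicit Types (x : 'rV[R]_d) (f g : 'rV[R]_d -> R) (i j : 'I_d).

(** Steps of either sign occur in expansions, hence no order on the endpoints. *)
Lemma cos_MVT (x y : R) :
  exists2 c, `|c - x| <= `|y - x| & cos y - cos x = - sin c * (y - x).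
Proof.
have MVT (a b : R) : a <= b ->
    exists2 c, c \in `[a, b] & cos b - cos a = - sin c * (b - a).
  move=> ab; apply: MVT_segment => //.
  by apply: continuous_subspaceT => z; exact: continuous_cos.
have [/MVT[c]|/ltW /MVT[c]] := leP x y; rewrite in_itv/= => /andP[ac cb] cE.
  by exists c => //; rewrite !ger0_norm; lra.
exists c; last by lra.
by rewrite !ler0_norm; lra.
Qed.

Lemma sinB_le (x y : R) : `|sin y - sin x| <= `|y - x|.
Proof.
rewrite -!cosBpihalf; have [c _ ->] := cos_MVT (x - pi / 2) (y - pi / 2).
rewrite (_ : y - pi / 2 - (x - pi / 2) = y - x); last by ring.
rewrite normrM -[leRHS]mul1r ler_wpM2r// normrN ler_norml.
by rewrite sin_geN1 sin_le1.
Qed.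

Lemma has_partial_cos j (L : 'rV[R]_d -> R) (m : R) :
  (forall x h, L (step j h x) = L x + h * m) ->
  has_partial j (fun x => cos (L x)) (fun x => - (m * sin (L x))).
Proof.
move=> Lm; exists (1 + `|m| + `|m| ^+ 2).
have cos1 y : `|cos y : R| <= 1 by rewrite ler_norml cos_geN1 cos_le1.
have sin1 y : `|sin y : R| <= 1 by rewrite ler_norml sin_geN1 sin_le1.
have m0 := normr_ge0 m; have mm0 := sqr_ge0 `|m|.
split=> [x|x|x h h1].
- by have := cos1 (L x) => *; lra.
- rewrite normrN normrM; have := ler_wpM2l m0 (sin1 (L x)) => *; lra.
- rewrite Lm; have [c cx ->] := cos_MVT (L x) (L x + h * m).
  have hm : L x + h * m - L x = h * m by ring.
  rewrite hm in cx *.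
  rewrite (_ : _ - _ = - (h * m * (sin c - sin (L x)))); last by ring.
  rewrite normrN normrM; apply: (@le_trans _ _ (`|h * m| * `|h * m|)).
    by rewrite ler_wpM2l// (le_trans (sinB_le _ _)).
  rewrite -expr2 normrM exprMn [`|h| ^+ 2]real_normK ?num_real// mulrC.
  by apply: ler_wpM2r; [exact: sqr_ge0 | lra].
Qed.

Lemma has_partial_sin j (L : 'rV[R]_d -> R) (m : R) :
  (forall x h, L (step j h x) = L x + h * m) ->
  has_partial j (fun x => sin (L x)) (fun x => m * cos (L x)).
Proof.
move=> Lm; have Lm' x h : L (step j h x) - pi / 2 = L x - pi / 2 + h * m.
  by rewrite Lm; ring.
apply: has_partial_eq (has_partial_cos Lm') => x; rewrite ?cosBpihalf//.
by rewrite -[in RHS](subrK (pi / 2) (L x)) cosDpihalf mulrN.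
Qed.

Lemma step_coord i j x (h : R) : (step j h x) 0 i = x 0 i + h * (i == j)%:R.
Proof. by rewrite /step !mxE eqxx. Qed.

Variable e : R.

(** The multiplier of the discrete Laplacian, raised by e to stay away from 0. *)
Definition symb x : R := e + \sum_j (2 - 2 * cos (x 0 j)).

Local Notation W := symb.
Local Notation V x := (W x)^-1.
Local Notation W' j x := (2 * sin (x 0 j)).
Local Notation W'' j x := (2 * cos (x 0 j)).

Lemma symb_ge x : e <= W x.
Proof.
rewrite lerDl sumr_ge0// => j _; rewrite subr_ge0 ger_pMr//.
Qed.

Lemma has_partial_symb j : has_partial j W (fun x => W' j x).
Proof.
apply: (@has_partial_eq _ _ _ (fun x => e + \sum_i (2 - 2 * cos (x 0 i)))
  (fun x => 0 + \sum_i (0 + -2 * - ((i == j)%:R * sin (x 0 i))))) => // [x|].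
  rewrite add0r (bigD1 j)//= eqxx mul1r big1 => [|i /negPf ->].
    by rewrite addr0 add0r mulrNN.
  by rewrite mul0r oppr0 mulr0 addr0.
apply: has_partialD; first exact: has_partial_cst.
apply: has_partial_sum => i.
have := has_partialD (has_partial_cst j 2)
  (has_partialZ (-2) (@has_partial_cos j (fun x => x 0 i) _ (step_coord i j))).
by apply: has_partial_eq => // x; rewrite mulNr.
Qed.

Lemma has_partial_symb' i j :
  has_partial i (fun x => W' j x) (fun x => (i == j)%:R * W'' j x).
Proof.
have := has_partialZ 2 (@has_partial_sin i (fun x => x 0 j) _ (step_coord j i)).
by apply: has_partial_eq => // x; rewrite [j == i]eq_sym; ring.
Qed.

Hypothesis e0 : 0 < e.

Lemma symb_gt0 x : 0 < W x.
Proof. exact: lt_le_trans e0 (symb_ge x). Qed.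

Lemma has_partial_weight j k :
  has_partial j (fun x => V x ^+ k) (fun x => - k%:R * V x ^+ k.+1 * W' j x).
Proof.
have dV := has_partialV e0 symb_ge (has_partial_symb j).
elim: k => [|k ihk].
  apply: has_partial_eq (has_partial_cst j 1) => x; rewrite ?expr0//.
  by rewrite mulNr !mul0r oppr0 mul0r.
apply: has_partial_eq (has_partialM dV ihk) => x; rewrite ?exprS//.
by rewrite -natr1; ring.
Qed.

(** Termwise 4 sin^2 = 4 (1 - cos) (1 + cos) <= 4 (2 - 2 cos). *)
Lemma grad_symb_le x : \sum_j W' j x ^+ 2 <= 4 * W x.
Proof.
rewrite /symb mulrDr mulr_sumr.
apply: ler_wpDl; first by rewrite mulr_ge0// ltW.
apply: ler_sum => j _.
have := cos_geN1 (x 0 j); have := cos_le1 (x 0 j); have := cos2Dsin2 (x 0 j).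
by move: (cos _) (sin _) => c s *; nra.
Qed.

Lemma lap_symb_ge x : 2 * d%:R - W x <= \sum_j W'' j x.
Proof.
rewrite /symb sumrB sumr_const card_ord -mulr_natr.
by have := e0 => *; lra.
Qed.

Lemma grad_symb_div_le x : V x * (\sum_j W' j x ^+ 2) <= 4.
Proof.
have W0 := symb_gt0 x.
by rewrite mulrC ler_pdivrMr//; exact: grad_symb_le.
Qed.

Lemma lap_symb_div_ge x : 2 * d%:R * V x - 1 <= V x * (\sum_j W'' j x).
Proof.
have W0 := symb_gt0 x.
have := lap_symb_ge x.
by rewrite -(@ler_pM2l _ (V x)) ?invr_gt0// mulrBr mulVf ?gt_eqF// [V x * (2 * _)]mulrC.
Qed.

(** With v = 1/W, the square of grad f - b f v grad W, integrated against v^k. The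
    mixed term is integrated by parts with the field - b v^(k+1) f^2 grad W, whose
    divergence contains Laplacian W >= 2 d - W (the main term, and the term in
    v^k) and (k + 1) v |grad W|^2 <= 4 (k + 1). *)
Lemma weighted_hardy k (b : R) f (f' : 'I_d -> 'rV[R]_d -> R) : b <= 0 ->
  (forall j, has_partial j f (f' j)) ->
  mean_le (fun x => 4 * hfun d k b * (V x ^+ k.+1 * f x ^+ 2))
          (fun x => V x ^+ k * (\sum_j f' j x ^+ 2) - b * (V x ^+ k * f x ^+ 2)).
Proof.
move=> b0 ff'.
pose F j x := - b * (V x ^+ k.+1 * (W' j x * (f x * f x))).
pose F' j x := - b * (- k.+1%:R * V x ^+ k.+2 * W' j x * (W' j x * (f x * f x)) +
  V x ^+ k.+1 * ((j == j)%:R * W'' j x * (f x * f x) +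
     W' j x * (f' j x * f x + f x * f' j x))).
have FF' j : has_partial j (F j) (F' j).
  exact: has_partialZ (has_partialM (has_partial_weight j k.+1)
    (has_partialM (has_partial_symb' j j) (has_partialM (ff' j) (ff' j)))).
apply: (mean_le_divergence FF') => x.
pose A := \sum_j f' j x ^+ 2; pose B := \sum_j W' j x * f' j x.
pose C := \sum_j W' j x ^+ 2; pose L := \sum_j W'' j x.
pose v := V x.
have v0 : 0 < v by rewrite invr_gt0; exact: symb_gt0.
have vC : v * C <= 4 := grad_symb_div_le x.
have vL : 2 * d%:R * v - 1 <= v * L := lap_symb_div_ge x.
rewrite (_ : \sum_j F' j x = - b * (- k.+1%:R * v ^+ k.+2 * C * f x ^+ 2 +
    v ^+ k.+1 * (L * f x ^+ 2) + v ^+ k.+1 * (2 * f x) * B)); last first.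
  rewrite /F' -mulr_sumr; congr (_ * _).
  rewrite /C /L /B !mulr_sumr !mulr_suml mulr_sumr -!big_split/=.
  apply: eq_bigr => j _; rewrite eqxx -/v mul1r; ring.
have sq : 0 <= A - 2 * b * (v * f x) * B + b ^+ 2 * v ^+ 2 * f x ^+ 2 * C.
  rewrite (_ : _ + _ = \sum_j (f' j x - b * W' j x * v * f x) ^+ 2).
    by apply: sumr_ge0 => j _; exact: sqr_ge0.
  rewrite /A /B /C !mulr_sumr -sumrB -big_split/=.
  by apply: eq_bigr => j _; ring.
have q0 : 0 <= v ^+ k by rewrite exprn_ge0// ltW.
have p0 := sqr_ge0 (f x).
have H1 := mulr_ge0 q0 sq.
have H2 : 0 <= (b ^+ 2 - b * k.+1%:R) * (v * v ^+ k * f x ^+ 2) * (4 - v * C).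
  apply: mulr_ge0; last by rewrite subr_ge0.
  apply: mulr_ge0; last by rewrite mulr_ge0// mulr_ge0// ltW.
  by rewrite addr_ge0 ?sqr_ge0// -mulNr mulr_ge0// oppr_ge0.
have H3 : 0 <= - b * (v ^+ k * f x ^+ 2) * (v * L - (2 * d%:R * v - 1)).
  apply: mulr_ge0; last by rewrite subr_ge0.
  by apply: mulr_ge0; [rewrite oppr_ge0|exact: mulr_ge0].
rewrite -subr_ge0; have := addr_ge0 (addr_ge0 H1 H2) H3; congr (0 <= _).
by rewrite -/A -/v /hfun !exprS -natr1; field.
Qed.

End Symbol.

(** * The weighted Rellich inequality *)

Section Hessian.
Variables (R : realType) (d : nat) (e : R).
Hypothesis e0 : 0 < e.
Implicit Types (x : 'rV[R]_d) (f g : 'rV[R]_d -> R) (i j : 'I_d).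

Local Notation W := (symb e).
Local Notation V x := (W x)^-1.
Local Notation W' j x := (2 * sin (x 0 j)).
Local Notation W'' j x := (2 * cos (x 0 j)).
Local Notation Vp k i x := (- k%:R * V x ^+ k.+1 * W' i x).
Local Notation Vpp k i j x :=
  (- k%:R * ((- k.+1%:R * V x ^+ k.+2 * W' i x) * W' j x +
             V x ^+ k.+1 * ((i == j)%:R * W'' j x))).

Lemma has_partial_weight' i j k :
  has_partial i (fun x => Vp k j x) (fun x => Vpp k i j x).
Proof.
have := has_partialZ (- k%:R)
  (has_partialM (has_partial_weight e0 i k.+1) (has_partial_symb' R i j)).
by apply: has_partial_eq => x //; rewrite mulrA.
Qed.

(** The identity behind the comparison of Hessian and Laplacian, for one pair of
    indices and before summation: the third derivatives of f cancel, and two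
    fields, one in each direction, absorb everything that is not a square. *)
Lemma hessian_pair k i j (fi fj fii fij fjj fiij : 'rV[R]_d -> R) :
  has_partial i fi fii -> has_partial j fi fij ->
  has_partial i fj fij -> has_partial j fj fjj ->
  has_partial i fij fiij -> has_partial j fii fiij ->
  mean_le
    (fun x => V x ^+ k * fij x ^+ 2 + (Vpp k i j x * (fi x * fj x)
        - (Vpp k j j x * fi x ^+ 2 + Vpp k i i x * fj x ^+ 2) / 2))
    (fun x => V x ^+ k * (fii x * fjj x)).
Proof.
move=> dii dij dji djj diij djii.
have dV (l : 'I_d) := has_partial_weight e0 l k.
have dV' l m := has_partial_weight' l m k.
have PA := has_partialD (has_partialM (dV j) (has_partialM djii djj))
  (has_partialZ 2^-1 (has_partialM (dV' j j) (has_partialM dij dij))).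
have PB := has_partialD (has_partialZ (-1) (has_partialM (dV i) (has_partialM diij dji)))
  (has_partialD (has_partialZ (-1) (has_partialM (dV' i j) (has_partialM dii dji)))
     (has_partialZ 2^-1 (has_partialM (dV' i i) (has_partialM dji dji)))).
set f := (X in mean_le X _); set g := (X in mean_le _ X).
apply: (@mean_le_trans _ _ (fun x => f x + (Vp k j x * (fii x * fj x) +
   V x ^+ k * (fiij x * fj x + fii x * fjj x) +
   2^-1 * (Vpp k j j x * (fi x * fi x) +
           Vp k j x * (fij x * fi x + fi x * fij x))))).
  apply: (mean_le_partial (has_partialZ (-1) PA)) => x.
  by rewrite mulN1r addrK.
apply: (mean_le_partial (has_partialZ (-1) PB)) => x.
rewrite /f /g !eqxx !mul1r; move: (V x) => v.
by rewrite le_eqVlt; apply/orP; left; apply/eqP; field.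
Qed.

(** Summing [hessian_pair] gives, with v = 1/W,
    int v^k |Laplacian f|^2 = int v^k |Hessian f|^2 + terms in the second
    derivatives of v^k, and the latter are at least
    (2 k d - 4 k^2 - 6 k) v^(k+1) |grad f|^2 - k v^k |grad f|^2. The Hessian
    is bounded below by [weighted_hardy] for each partial derivative of f. The
    family f' stands for grad f, f'' for its Hessian and f3 i j for the mixed
    third derivative in the directions i, i, j. *)
Lemma weighted_rellich k (a : R) (f' : 'I_d -> 'rV[R]_d -> R)
    (f'' f3 : 'I_d -> 'I_d -> 'rV[R]_d -> R) : a <= 0 ->
  (forall i j, has_partial j (f' i) (f'' i j)) ->
  (forall i j, f'' i j = f'' j i) ->
  (forall i j, has_partial i (f'' i j) (f3 i j)) ->
  (forall i j, has_partial j (f'' i i) (f3 i j)) ->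
  mean_le (fun x => 4 * rfun d k a * (V x ^+ k.+1 * (\sum_i f' i x ^+ 2)))
          (fun x => V x ^+ k * (\sum_i f'' i i x) ^+ 2 +
             (k%:R - a) * (V x ^+ k * (\sum_i f' i x ^+ 2))).
Proof.
move=> a0 d1 sym d2 d3.
have d1' i j : has_partial i (f' j) (f'' i j) by rewrite sym.
have M1 := mean_le_sum (index_enum 'I_d) (fun i => mean_le_sum (index_enum 'I_d)
  (fun j => hessian_pair k (d1 i i) (d1 i j) (d1' i j) (d1 j j) (d2 i j) (d3 i j))).
have M2 := mean_le_sum (index_enum 'I_d)
  (fun i => weighted_hardy e0 k a0 (fun j => d1 i j)).
apply: (mean_le_shift (mean_leD M1 M2)) => x /=.
pose P := \sum_i f' i x ^+ 2; pose B := \sum_j W' j x * f' j x.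
pose C := \sum_j W' j x ^+ 2; pose L := \sum_j W'' j x.
pose D := \sum_j W'' j x * f' j x ^+ 2.
pose v := V x; pose H := \sum_i \sum_j f'' i j x ^+ 2.
have v0 : 0 < v by rewrite invr_gt0; exact: symb_gt0.
have vC : v * C <= 4 := grad_symb_div_le e0 x.
have vL : 2 * d%:R * v - 1 <= v * L := lap_symb_div_ge e0 x.
have P0 : 0 <= P by apply: sumr_ge0 => i _; exact: sqr_ge0.
have DP : D <= 2 * P.
  rewrite mulr_sumr; apply: ler_sum => j _; rewrite ler_wpM2r ?sqr_ge0//.
  by rewrite ger_pMr.
have diag_sum (g h : 'I_d -> R) :
    \sum_i \sum_j g i * h j = (\sum_i g i) * (\sum_j h j).
  by rewrite mulr_suml; apply: eq_bigr => i _; rewrite mulr_sumr.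
have -> : \sum_i \sum_j V x ^+ k * (f'' i i x * f'' j j x) =
    v ^+ k * (\sum_i f'' i i x) ^+ 2.
  rewrite expr2 -diag_sum mulr_sumr; apply: eq_bigr => i _.
  by rewrite mulr_sumr.
have -> : \sum_i 4 * hfun d k a * (V x ^+ k.+1 * f' i x ^+ 2) =
    4 * hfun d k a * (v ^+ k.+1 * P) by rewrite -!mulr_sumr.
have -> : \sum_i (V x ^+ k * \sum_j f'' i j x ^+ 2 - a * (V x ^+ k * f' i x ^+ 2)) =
    v ^+ k * H - a * (v ^+ k * P) by rewrite sumrB -!mulr_sumr.
have -> : \sum_i \sum_j (V x ^+ k * f'' i j x ^+ 2 + (Vpp k i j x * (f' i x * f' j x)
        - (Vpp k j j x * f' i x ^+ 2 + Vpp k i i x * f' j x ^+ 2) / 2)) =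
   v ^+ k * H + (k%:R * k.+1%:R * v ^+ k.+2 * B ^+ 2 - k%:R * v ^+ k.+1 * D)
   - (k%:R * k.+1%:R * v ^+ k.+2 * C - k%:R * v ^+ k.+1 * L) * P.
  (* U j is the second derivative of v^k in the direction j *)
  pose c1 := k%:R * v ^+ k.+1; pose c2 := k%:R * k.+1%:R * v ^+ k.+2.
  pose U j := c2 * W' j x ^+ 2 - c1 * W'' j x.
  have US : \sum_j U j = c2 * C - c1 * L by rewrite sumrB /C /L !mulr_sumr.
  have DS : D = \sum_i \sum_j (i == j)%:R * (W'' j x * (f' i x * f' j x)).
    apply: eq_bigr => i _; rewrite (bigD1 i)//= eqxx mul1r big1 ?addr0.
      by rewrite expr2.
    by move=> j /negPf ij; rewrite eq_sym ij mul0r.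
  have UP : \sum_i \sum_j (f' i x ^+ 2 * U j + U i * f' j x ^+ 2) / 2 =
      (\sum_j U j) * P.
    transitivity ((P * (\sum_j U j) + (\sum_j U j) * P) / 2); last by field.
    rewrite -(diag_sum U) -(diag_sum (fun i => f' i x ^+ 2)) -big_split mulr_suml.
    by apply: eq_bigr => i _; rewrite -big_split mulr_suml.
  rewrite -/c1 -/c2 -US -UP expr2 -(diag_sum (fun j => W' j x * f' j x)) DS /H.
  rewrite !mulr_sumr -sumrB -big_split -sumrB; apply: eq_bigr => i _.
  rewrite !mulr_sumr -sumrB -big_split -sumrB; apply: eq_bigr => j _.
  rewrite /U /c1 /c2 /= !eqxx !mul1r.
  by have [<-|_] := eqVneq i j; rewrite ?mul1r ?mul0r -/v; field.
rewrite -/P -/v /rfun.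
have q0 : 0 <= v ^+ k by rewrite exprn_ge0// ltW.
have [v0' k0 k1] : [/\ 0 <= v, 0 <= k%:R :> R & 0 <= k.+1%:R :> R].
  by split=> //; exact: ltW.
have kv : 0 <= k%:R * (v * v ^+ k) by do ?apply: mulr_ge0.
have H1 : 0 <= k%:R * (v * v ^+ k) * (2 * P - D).
  by apply: mulr_ge0; rewrite ?subr_ge0.
have H2 : 0 <= k%:R * (v * v ^+ k) * k.+1%:R * P * (4 - v * C).
  by do ?apply: mulr_ge0; rewrite ?subr_ge0.
have H3 : 0 <= k%:R * v ^+ k * P * (v * L - (2 * d%:R * v - 1)).
  by do ?apply: mulr_ge0; rewrite ?subr_ge0.
have H4 : 0 <= k%:R * k.+1%:R * v ^+ k.+2 * B ^+ 2.
  apply: mulr_ge0; last exact: sqr_ge0.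
  by apply: mulr_ge0; [exact: mulr_ge0 | exact: exprn_ge0].
rewrite -subr_ge0; have := addr_ge0 (addr_ge0 H1 H2) (addr_ge0 H3 H4).
by congr (0 <= _); rewrite !exprS -[k.+1%:R]natr1; field.
Qed.
End Hessian.

(** * Trigonometric polynomials *)

Section Waves.
Variables (R : realType) (d : nat).
Implicit Types (x : 'rV[R]_d) (n m : 'rV[int]_d) (i j : 'I_d).
Implicit Types (s : seq 'rV[int]_d) (a b : 'rV[int]_d -> R) (t : R).

Definition dot n x : R := \sum_j (n 0 j)%:~R * x 0 j.

(** The phase t makes one family out of cosines and sines: differentiation adds
    pi/2 to it, and [wave_sqr] is the squared modulus of sum_n a_n e^(i n.x)
    whatever t is. *)
Definition wave s a t x : R := \sum_(n <- s) a n * cos (dot n x + t).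

Definition wave_sqr s a t x : R := wave s a t x ^+ 2 + wave s a (t + pi / 2) x ^+ 2.

(** Coefficients of the j-th partial derivative, up to the phase. *)
Definition freqmul j a n : R := (n 0 j)%:~R * a n.

Definition nsq n : R := \sum_j (n 0 j)%:~R ^+ 2.

Lemma dot_step j n x (h : R) : dot n (step j h x) = dot n x + h * (n 0 j)%:~R.
Proof.
rewrite /dot (eq_bigr (fun i => (n 0 i)%:~R * x 0 i +
  (n 0 i)%:~R * (h * (i == j)%:R))); last first.
  by move=> i _; rewrite step_coord mulrDr.
rewrite big_split/=; congr (_ + _); rewrite (bigD1 j)//= eqxx mulr1 mulrC.
by rewrite big1 ?addr0// => i /negPf ->; rewrite !mulr0.
Qed.

Lemma has_partial_wave j s a t :
  has_partial j (wave s a t) (wave s (freqmul j a) (t + pi / 2)).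
Proof.
apply: has_partial_sum => n.
have L x h : dot n (step j h x) + t = (dot n x + t) + h * (n 0 j)%:~R.
  by rewrite dot_step addrAC.
apply: has_partial_eq (has_partialZ (a n) (has_partial_cos L)) => // x.
by rewrite /freqmul addrA cosDpihalf; ring.
Qed.

Lemma nsq_ge0 n : 0 <= nsq n.
Proof. by apply: sumr_ge0 => j _; exact: sqr_ge0. Qed.

Lemma nsq_eq0 n : (nsq n == 0) = (n == 0).
Proof.
apply/idP/eqP => [|->]; last by rewrite /nsq big1// => j _; rewrite mxE expr0n.
rewrite psumr_eq0 => [/allP n0|j _]; last exact: sqr_ge0.
apply/rowP => j; rewrite mxE.
have := n0 j (mem_index_enum j); rewrite implyTb sqrf_eq0 intr_eq0.
by move/eqP.
Qed.

Lemma nsq_ge1 n : n != 0 -> 1 <= nsq n.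
Proof.
rewrite -nsq_eq0 => n0; pose k : int := \sum_j n 0 j ^+ 2.
have nk : nsq n = k%:~R by rewrite rmorph_sum; apply: eq_bigr => j _; rewrite rmorphXn.
move: n0 (nsq_ge0 n); rewrite nk intr_eq0 ler0z (ler1z R) => k0 kge.
by rewrite -gtz0_ge1 lt_def k0.
Qed.

(** Off-diagonal terms are multiples of cos((n - m).x), a partial derivative in
    any direction in which n and m differ. *)
Lemma parseval_le s a b t : uniq s ->
  mean_le (fun x => wave s a t x * wave s b t x +
                    wave s a (t + pi / 2) x * wave s b (t + pi / 2) x)
          (fun=> \sum_(n <- s) a n * b n).
Proof.
move=> us.
have term n m : mean_le (fun x => a n * b m * cos (dot n x - dot m x))
    (fun=> (n == m)%:R * (a n * b m)).
  have [->|nm] := eqVneq n m.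
    by apply: mean_leW => x; rewrite subrr cos0 mulr1 mul1r.
  have [j nmj] : exists j, n 0 j != m 0 j.
    apply/existsP; apply: contraNT nm => /existsPn nm.
    by apply/eqP/rowP => j; apply/eqP; have := nm j; rewrite negbK.
  pose c : R := (n 0 j)%:~R - (m 0 j)%:~R.
  have c0 : c != 0 by rewrite subr_eq0 eqr_int.
  have L x h : dot n (step j h x) - dot m (step j h x) =
      (dot n x - dot m x) + h * c.
    by rewrite !dot_step /c; ring.
  apply: (mean_le_partial (has_partialZ (a n * b m / c) (has_partial_sin L))) => x.
  by rewrite mul0r add0r [_ / c * _]mulrA divfK.
apply: (mean_le_shift (mean_le_sum s (fun n => mean_le_sum s (term n)))) => x /=.
apply: lerB.
  rewrite /wave !mulr_suml -big_split le_eqVlt; apply/orP; left; apply/eqP.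
  apply: eq_bigr => n _; rewrite !mulr_sumr -big_split; apply: eq_bigr => m _ /=.
  rewrite !addrA !cosDpihalf (_ : dot n x - dot m x = (dot n x + t) - (dot m x + t)).
    by rewrite cosB; ring.
  by ring.
rewrite le_eqVlt; apply/orP; left; apply/eqP.
rewrite [LHS]big_seq [RHS]big_seq; apply: eq_bigr => n ns.
rewrite (bigD1_seq n)//= eqxx mul1r big1 ?addr0// => m.
by rewrite eq_sym => /negPf ->; rewrite mul0r.
Qed.

Lemma parseval_ge s a b t : uniq s ->
  mean_le (fun=> \sum_(n <- s) a n * b n)
          (fun x => wave s a t x * wave s b t x +
                    wave s a (t + pi / 2) x * wave s b (t + pi / 2) x).
Proof.
move=> us; apply: (mean_le_shift (parseval_le (fun n => - a n) b t us)) => x.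
have waveN u : wave s (fun n => - a n) u x = - wave s a u x.
  by rewrite /wave -sumrN; apply: eq_bigr => n _; rewrite mulNr.
have sumN : \sum_(n <- s) - a n * b n = - \sum_(n <- s) a n * b n.
  by rewrite -sumrN; apply: eq_bigr => n _; rewrite mulNr.
by rewrite !waveN sumN; lra.
Qed.

Lemma wave_bound s a t x : `|wave s a t x| <= \sum_(n <- s) `|a n|.
Proof.
apply: le_trans (ler_norm_sum _ _ _) _; apply: ler_sum => n _.
by rewrite normrM ler_piMr// ler_norml cos_geN1 cos_le1.
Qed.

Lemma wave_sqr_ge0 s a t x : 0 <= wave_sqr s a t x.
Proof. by rewrite addr_ge0 ?sqr_ge0. Qed.

Lemma wave_sqr_bound s a t x : wave_sqr s a t x <= 2 * (\sum_(n <- s) `|a n|) ^+ 2.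
Proof.
have sq u : wave s a u x ^+ 2 <= (\sum_(n <- s) `|a n|) ^+ 2.
  rewrite -[wave s a u x ^+ 2]real_normK ?num_real// lerXn2r ?nnegrE//.
    by apply: sumr_ge0.
  exact: wave_bound.
by rewrite mulr2n mulrDl mul1r lerD.
Qed.

Lemma lap_wave s a t x :
  \sum_j wave s (freqmul j (freqmul j a)) t x = wave s (fun n => nsq n * a n) t x.
Proof.
rewrite /wave exchange_big/=; apply: eq_bigr => n _.
rewrite -mulr_suml; congr (_ * _); rewrite /nsq mulr_suml.
by apply: eq_bigr => j _; rewrite /freqmul mulrA -expr2.
Qed.

End Waves.

(** * Hardy inequalities on the torus *)

Section TorusHardy.
Variables (R : realType) (d : nat).
Implicit Types (x : 'rV[R]_d) (n m : 'rV[int]_d) (i j : 'I_d).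
Implicit Types (s : seq 'rV[int]_d) (a b : 'rV[int]_d -> R) (t e : R).

(** Uniformity in e matters: e tends to 0 only after the duality argument. *)
Definition torus_hardy (l : nat) (C : R) : Prop :=
  forall e s a t, 0 < e -> uniq s -> a 0 = 0 ->
  mean_le (fun x => C * ((symb e x)^-1 ^+ l * wave_sqr s a t x))
          (fun=> \sum_(n <- s) nsq R n ^+ l * a n ^+ 2).

Lemma torus_hardy0 : torus_hardy 0 1.
Proof.
move=> e s a t e0 us a0; apply: (mean_le_shift (parseval_le a a t us)) => x.
by rewrite !mul1r lerB// le_eqVlt; apply/orP; left; apply/eqP;
  apply: eq_bigr => n _; rewrite mul1r.
Qed.

(** The coefficients n_j a(n) of the partial derivatives also vanish at 0, and the
    squares of the n_j add up to |n|^2. *)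
Lemma torus_hardy_grad l C e s a t : 0 < e -> uniq s -> torus_hardy l C ->
  mean_le (fun x => C * ((symb e x)^-1 ^+ l * (\sum_j wave_sqr s (freqmul j a) t x)))
          (fun=> \sum_(n <- s) nsq R n ^+ l.+1 * a n ^+ 2).
Proof.
move=> e0 us hC.
have cf0 j : freqmul j a 0 = 0 by rewrite /freqmul mxE mul0r.
apply: (mean_le_shift (mean_le_sum (index_enum 'I_d)
  (fun j => hC e s _ t e0 us (cf0 j)))) => x.
rewrite -!mulr_sumr exchange_big lerB// le_eqVlt; apply/orP; left; apply/eqP => /=.
apply: eq_bigr => n _; rewrite exprSr -mulrA /nsq mulr_suml mulr_sumr.
by apply: eq_bigr => j _; rewrite /freqmul exprMn.
Qed.

(** Poincare inequality for coefficients without zero mode. *)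
Lemma nsq_poincare s a (k l : nat) : (k <= l)%N -> a 0 = 0 ->
  \sum_(n <- s) nsq R n ^+ k * a n ^+ 2 <= \sum_(n <- s) nsq R n ^+ l * a n ^+ 2.
Proof.
move=> kl a0; apply: ler_sum => n _.
have [->|n0] := eqVneq n 0; first by rewrite a0 expr0n !mulr0.
by rewrite ler_wpM2r ?sqr_ge0// ler_weXn2l// nsq_ge1.
Qed.

Lemma torus_hardy_poincare l k C e s a t : (l <= k)%N ->
  0 < e -> uniq s -> a 0 = 0 -> torus_hardy l C ->
  mean_le (fun x => C * ((symb e x)^-1 ^+ l * wave_sqr s a t x))
          (fun=> \sum_(n <- s) nsq R n ^+ k * a n ^+ 2).
Proof.
move=> lk e0 us a0 hC; apply: mean_le_trans (hC e s a t e0 us a0) _.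
by apply: mean_leW => x; exact: nsq_poincare.
Qed.

Lemma hardy_wave k (b : R) e s a t : 0 < e -> b <= 0 ->
  mean_le (fun x => 4 * hfun d k b * ((symb e x)^-1 ^+ k.+1 * wave_sqr s a t x))
    (fun x => (symb e x)^-1 ^+ k * (\sum_j wave_sqr s (freqmul j a) (t + pi / 2) x)
       - b * ((symb e x)^-1 ^+ k * wave_sqr s a t x)).
Proof.
move=> e0 b0.
have H u := weighted_hardy e0 k b0 (fun j => has_partial_wave j s a u).
apply: (mean_le_shift (mean_leD (H t) (H (t + pi / 2)))) => x /=.
by rewrite big_split /wave_sqr/=; lra.
Qed.

Lemma freqmulC i j a : freqmul i (freqmul j a) = freqmul j (freqmul i a).
Proof. by apply/funext => n; rewrite /freqmul mulrCA. Qed.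

Lemma rellich_wave k (b : R) e s a t : 0 < e -> b <= 0 ->
  mean_le
    (fun x => 4 * rfun d k b *
       ((symb e x)^-1 ^+ k.+1 * (\sum_j wave_sqr s (freqmul j a) (t + pi / 2) x)))
    (fun x => (symb e x)^-1 ^+ k *
         wave_sqr s (fun n => nsq R n * a n) (t + pi / 2 + pi / 2) x +
       (k%:R - b) *
         ((symb e x)^-1 ^+ k * (\sum_j wave_sqr s (freqmul j a) (t + pi / 2) x))).
Proof.
move=> e0 b0.
have H' u : mean_le
    (fun x => 4 * rfun d k b *
       ((symb e x)^-1 ^+ k.+1 * (\sum_j wave s (freqmul j a) u x ^+ 2)))
    (fun x => (symb e x)^-1 ^+ k *
         wave s (fun n => nsq R n * a n) (u + pi / 2) x ^+ 2 +
       (k%:R - b) *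
         ((symb e x)^-1 ^+ k * (\sum_j wave s (freqmul j a) u x ^+ 2))).
  have sym i j : wave s (freqmul j (freqmul i a)) (u + pi / 2) =
      wave s (freqmul i (freqmul j a)) (u + pi / 2) by rewrite freqmulC.
  have d3 i j : has_partial j (wave s (freqmul i (freqmul i a)) (u + pi / 2))
      (wave s (freqmul i (freqmul j (freqmul i a))) (u + pi / 2 + pi / 2)).
    by rewrite -(freqmulC j i); exact: has_partial_wave.
  apply: (mean_le_shift (weighted_rellich e0 k b0
    (fun i j => has_partial_wave j s (freqmul i a) u) sym
    (fun i j => has_partial_wave i s _ _) d3)) => x.
  by rewrite lap_wave.
apply: (mean_le_shift (mean_leD (H' (t + pi / 2)) (H' (t + pi / 2 + pi / 2)))) => x /=.
by rewrite big_split /wave_sqr/=; lra.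
Qed.

(** [hardy_wave] with exponent l; the gradient term is controlled by
    [torus_hardy_grad] and the other one by the Poincare inequality. *)
Lemma torus_hardy_step l C (b : R) : 0 < C -> b < 0 ->
  torus_hardy l C -> torus_hardy l.+1 (4 * C * (hfun d l b / (1 - b))).
Proof.
move=> C0 b0 hC e s a t e0 us a0.
set N := \sum_(n <- s) _.
have b1 : 0 < 1 - b by rewrite subr_gt0 (lt_trans b0).
have c0 : 0 <= C / (1 - b) by rewrite divr_ge0// ltW.
have G := torus_hardy_grad a (t + pi / 2) e0 us hC.
have P := torus_hardy_poincare t (leqnSn l) e0 us a0 hC.
have H := mean_leZ c0 (hardy_wave l s a t e0 (ltW b0)).
have b1V : 0 <= (1 - b)^-1 by rewrite invr_ge0 ltW.
have Nb : 0 <= - b / (1 - b) by rewrite divr_ge0 ?oppr_ge0 ?ltW.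
apply: (mean_le_shift (mean_leD H (mean_leD (mean_leZ b1V G) (mean_leZ Nb P)))) => x.
rewrite /= le_eqVlt; apply/orP; left; apply/eqP; rewrite -/N; field.
by rewrite gt_eqF.
Qed.

(** As in [torus_hardy_step], except that the gradient term is first reduced by
    [rellich_wave] to quantities with exponent l. Bounding the Laplacian term by
    N / C and the gradient term by (l - a) N / C, N being the right-hand sum,
    produces the numerator l + 1 - a of the first fraction. *)
Lemma torus_hardy_step2 l C C' (a b : R) : 0 < C -> 0 < C' -> a < 0 -> b < 0 ->
  0 < rfun d l a ->
  torus_hardy l C -> torus_hardy l.+1 C' ->
  torus_hardy l.+2 (4 * rfun d l a * hfun d l.+1 b /
    ((- a + l.+2%:R - 1) / (4 * C) - b * (rfun d l a / C'))).
Proof.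
move=> C0 C'0 a0 b0; set r := rfun d l a; set h := hfun d l.+1 b.
move=> r0 hC hC' e s u t e0 us u0.
set N := \sum_(n <- s) _; set D := _ - _.
have D0 : 0 < D.
  rewrite /D subr_gt0 (@lt_trans _ _ 0)//.
    by rewrite nmulr_rlt0// divr_gt0.
  rewrite divr_gt0// ?mulr_gt0// -natr1.
  by have : 0 <= l.+1%:R :> R by []; lra.
have Nu : \sum_(n <- s) nsq R n ^+ l * (nsq R n * u n) ^+ 2 = N.
  by apply: eq_bigr => n _; rewrite exprMn mulrA -exprD addn2.
have L := hC e s (fun n => nsq R n * u n) (t + pi / 2 + pi / 2) e0 us.
rewrite u0 mulr0 Nu in L; have {}L := L erefl.
have G := torus_hardy_grad u (t + pi / 2) e0 us hC.
have G' : mean_le (fun=> \sum_(n <- s) nsq R n ^+ l.+1 * u n ^+ 2)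
    (fun x : 'rV[R]_d => N).
  by apply: mean_leW => _; exact: nsq_poincare.
have P := torus_hardy_poincare t (leqnSn l.+1) e0 us u0 hC'.
have H := hardy_wave l.+1 s u t e0 (ltW b0).
have Q := rellich_wave l s u t e0 (ltW a0).
(* H is scaled so that its left side has the claimed constant; the other
   factors are then forced by the cancellation of all integrals but N. *)
have rD : 0 <= r / D by rewrite divr_ge0// ltW.
have DV : 0 <= (4 * D)^-1 by rewrite invr_ge0 mulr_ge0// ltW.
have CDV : 0 <= (4 * C * D)^-1 by rewrite invr_ge0 !mulr_ge0// ltW.
have lDV : 0 <= (l%:R - a) * (4 * C * D)^-1.
  by apply: mulr_ge0 => //; rewrite subr_ge0 (le_trans (ltW a0)).
have bDV : 0 <= - b * r / (C' * D).
  by rewrite divr_ge0// mulr_ge0 ?oppr_ge0// ltW.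
apply: (mean_le_shift (mean_leD (mean_leD (mean_leZ rD H) (mean_leZ DV Q))
  (mean_leD (mean_leD (mean_leZ CDV L) (mean_leZ bDV P))
    (mean_leZ lDV (mean_leD G G'))))) => x.
rewrite /= le_eqVlt; apply/orP; left; apply/eqP; rewrite -/N -/r -/h.
have NE : ((4 * C * D)^-1 - b * r / (C' * D) + (l%:R - a) * (4 * C * D)^-1) * N = N.
  have D0' : D != 0 by rewrite gt_eqF.
  rewrite -[RHS]mul1r -(divff D0'); congr (_ * _).
  transitivity (((- a + l.+2%:R - 1) / (4 * C) - b * (r / C')) / D) => //.
  rewrite -[l.+2%:R]natr1 -[l.+1%:R]natr1; field.
  by rewrite D0' !gt_eqF.
rewrite -[X in _ - X = _]NE; field.
by rewrite !gt_eqF.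
Qed.

(** The weight and the trigonometric polynomial are bounded, so that a constant
    close to the supremum costs only a small error. *)
Lemma torus_hardy_sup l (c : R) (E : set R) : 0 <= c -> has_sup E ->
  (forall C, E C -> torus_hardy l (c * C)) -> torus_hardy l (c * sup E).
Proof.
move=> c0 supE hE e s a t e0 us a0.
pose f x := c * ((symb e x)^-1 ^+ l * wave_sqr s a t x).
have fE (z : R) : (fun x => c * z * ((symb e x)^-1 ^+ l * wave_sqr s a t x)) =
    fun x => z * f x by apply/funext => x; rewrite /f; ring.
rewrite fE.
apply: (mean_le_sup (K := c * (e^-1 ^+ l * (2 * (\sum_(n <- s) `|a n|) ^+ 2)))) => //.
  move=> x; have W0 := symb_gt0 e0 x.
  have V0 : 0 <= (symb e x)^-1 by rewrite invr_ge0 ltW.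
  have Ve : (symb e x)^-1 <= e^-1 by rewrite lef_pV2 ?posrE// symb_ge.
  have Vl : 0 <= (symb e x)^-1 ^+ l by exact: exprn_ge0.
  apply/andP; split; first by rewrite mulr_ge0// mulr_ge0// wave_sqr_ge0.
  apply: ler_wpM2l => //.
  apply: ler_pM => //; [exact: wave_sqr_ge0| |exact: wave_sqr_bound].
  by apply: lerXn2r; rewrite ?nnegrE// invr_ge0 ltW.
by move=> C /hE/(_ _ _ _ t e0 us a0); rewrite fE.
Qed.

End TorusHardy.

(** * The constants *)

Section Constants.
Variables (R : realType).
Implicit Types (l d k : nat) (a b : R).

Definition odd_value d l b : R := hfun d l.+1 b / (1 - b).

Definition even_value d l (ab : R * R) : R :=
  4 * rfun d l ab.1 * hfun d l.+1 ab.2 /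
    ((- ab.1 + l.+2%:R - 1) / (4 * hardy_const R l d)
      - ab.2 * (rfun d l ab.1 / hardy_const R l.+1 d)).

Lemma admissibleE d l (ab : R * R) : admissible d l.+2 ab <->
  [/\ ab.1 < 0, ab.2 < 0, 0 < rfun d l ab.1 & 0 < hfun d l.+1 ab.2].
Proof. by rewrite /admissible /= subn2 subn1. Qed.

Lemma hardy_constSS d l : hardy_const R l.+2 d =
  if odd l then
    4 * hardy_const R l.+1 d *
    sup [set odd_value d l ab.2 | ab in @admissible R d l.+2]
  else sup [set even_value d l ab | ab in @admissible R d l.+2].
Proof.
have -> : hardy_const R l.+2 d =
    if odd l.+2 then 4 * hardy_const R l.+1 d *
      sup [set hfun d (l.+2 - 1) ab.2 / (1 - ab.2) | ab in @admissible R d l.+2]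
    else sup [set 4 * rfun d (l.+2 - 2) ab.1 * hfun d (l.+2 - 1) ab.2 /
       ((- ab.1 + l.+2%:R - 1) / (4 * hardy_const R l d)
       - ab.2 * (rfun d (l.+2 - 2) ab.1 / hardy_const R l.+1 d))
      | ab in @admissible R d l.+2] by [].
by rewrite subn2 subn1 /= negbK.
Qed.

Lemma hardy_const_odd d l : odd l -> hardy_const R l.+2 d =
  4 * hardy_const R l.+1 d *
    sup [set odd_value d l ab.2 | ab in @admissible R d l.+2].
Proof. by rewrite hardy_constSS => ->. Qed.

Lemma hardy_const_even d l : ~~ odd l -> hardy_const R l.+2 d =
  sup [set even_value d l ab | ab in @admissible R d l.+2].
Proof. by rewrite hardy_constSS => /negPf ->. Qed.

Lemma hfun_le d k b : b < 0 -> hfun d k b <= - b * (d%:R / 2).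
Proof.
move=> b0; have bb := sqr_ge0 b.
have bk : 0 <= - b * k%:R by rewrite mulr_ge0// oppr_ge0 ltW.
by rewrite /hfun; lra.
Qed.

Lemma rfun_m1_ge d l : (2 * l + 3 <= d)%N ->
  (d%:R - 2 * l%:R - 4) / 2 <= rfun d l (-1 : R).
Proof.
move=> ld; rewrite /rfun /hfun.
have : 0 <= l%:R * (d%:R - 2 * l%:R - 3) :> R.
  have : (2 * l + 3)%:R <= d%:R :> R by rewrite ler_nat.
  by rewrite natrD natrM => ?; rewrite mulr_ge0//; lra.
by move=> ?; lra.
Qed.

Lemma natr_gap l d : (2 * l.+2 < d)%N -> 1 <= d%:R - 2 * l%:R - 4 :> R.
Proof.
move=> ld; have : (2 * l + 5)%:R <= d%:R :> R by rewrite ler_nat; lia.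
by rewrite natrD natrM => ?; lra.
Qed.

(** The choice a = -1 is admissible in all the dimensions at hand, and enough for
    the asymptotics, because a enters the constant only at lower order in d. *)
Lemma admissible_m1 d l b : (2 * l.+2 < d)%N -> b < 0 -> 0 < hfun d l.+1 b ->
  @admissible R d l.+2 (-1, b).
Proof.
move=> ld b0 h0; apply/admissibleE; split=> //=.
apply: lt_le_trans (rfun_m1_ge _); last by lia.
have ? := natr_gap ld; lra.
Qed.

Lemma admissible_neq0 d l : (2 * l.+2 < d)%N -> @admissible R d l.+2 !=set0.
Proof.
move=> ld; have m0 := natr_gap ld.
exists (-1, - ((d%:R - 2 * l%:R - 4) / 4)); apply: admissible_m1 => //.
  by lra.
by rewrite /hfun -[l.+1%:R]natr1; nra.
Qed.

Lemma odd_value_le d l b : (2 * l.+2 < d)%N -> b < 0 ->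
  odd_value d l b <= d%:R / 2.
Proof.
move=> ld b0; have b1 : 0 < 1 - b by lra.
rewrite /odd_value ler_pdivrMr//.
apply: le_trans (hfun_le d l.+1 b0) _.
by rewrite mulrC ler_wpM2l//; lra.
Qed.

(** Dropping the first fraction leaves a quotient in which r cancels, hence the
    bound of [even_value_le]. *)
Lemma even_denominator d l (ab : R * R) : 0 < hardy_const R l d ->
  0 < hardy_const R l.+1 d -> admissible d l.+2 ab ->
  - ab.2 * (rfun d l ab.1 / hardy_const R l.+1 d) <=
  (- ab.1 + l.+2%:R - 1) / (4 * hardy_const R l d)
      - ab.2 * (rfun d l ab.1 / hardy_const R l.+1 d).
Proof.
move=> C0 C1 /admissibleE[a0 b0 r0 h0].
rewrite mulNr lerDr divr_ge0//; last by rewrite mulr_ge0// ltW.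
by rewrite -natr1; have : 0 <= l.+1%:R :> R by []; lra.
Qed.

Lemma even_value_le d l (ab : R * R) : (2 * l.+2 < d)%N ->
  0 < hardy_const R l d -> 0 < hardy_const R l.+1 d -> admissible d l.+2 ab ->
  even_value d l ab <= 2 * d%:R * hardy_const R l.+1 d.
Proof.
move=> ld C0 C1 adm; have := even_denominator C0 C1 adm.
case/admissibleE: adm => a0 b0 r0 h0; rewrite /even_value; set D := (X in _ <= X).
set r := rfun _ _ _ in r0 *; set h := hfun _ _ _ in h0 *.
set C := hardy_const R l.+1 d in C1 * => bD.
have b0' : 0 < - ab.2 * (r / C) by rewrite mulr_gt0 ?oppr_gt0// divr_gt0.
rewrite ler_pdivrMr; last exact: lt_le_trans bD.
have dC : 0 <= 2 * d%:R * C by rewrite mulr_ge0// ltW.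
apply: le_trans (ler_wpM2l dC bD).
have -> : 2 * d%:R * C * (- ab.2 * (r / C)) = 4 * r * (- ab.2 * (d%:R / 2)).
  by field; rewrite gt_eqF.
by rewrite ler_pM2l ?mulr_gt0// hfun_le.
Qed.

Lemma sqrt_half d : (0 < d)%N ->
  (Num.sqrt 2 / Num.sqrt d%:R : R) = (Num.sqrt (d%:R / 2))^-1.
Proof. by move=> d0; rewrite sqrtrM// sqrtrV// invfM invrK mulrC. Qed.

(** This is 4 h_0(b) / (1 - b) at its maximum, b = 1 - sqrt (d/2). *)
Lemma hardy_const1E d : (0 < d)%N ->
  hardy_const R 1 d = 4 * (Num.sqrt (d%:R / 2) - 1) ^+ 2.
Proof.
move=> d0; rewrite /= sqrt_half//; set y := Num.sqrt _.
have y2 : d%:R = 2 * y ^+ 2.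
  by rewrite sqr_sqrtr ?divr_ge0// mulrC divfK.
have y0 : y != 0.
  rewrite /y gt_eqF// sqrtr_gt0 divr_gt0// ltr0n//.
by rewrite y2; field.
Qed.

Lemma has_sup_odd d l : (2 * l.+2 < d)%N ->
  has_sup [set odd_value d l ab.2 | ab in @admissible R d l.+2].
Proof.
move=> ld; split.
  by have [ab abP] := admissible_neq0 ld; exists (odd_value d l ab.2), ab.
exists (d%:R / 2) => _ [ab /admissibleE[_ b0 _ _] <-].
exact: odd_value_le.
Qed.

Lemma has_sup_even d l : (2 * l.+2 < d)%N -> 0 < hardy_const R l d ->
  0 < hardy_const R l.+1 d ->
  has_sup [set even_value d l ab | ab in @admissible R d l.+2].
Proof.
move=> ld C0 C1; split.
  by have [ab abP] := admissible_neq0 ld; exists (even_value d l ab), ab.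
exists (2 * d%:R * hardy_const R l.+1 d) => _ [ab adm <-].
exact: even_value_le.
Qed.

Lemma odd_value_gt0 d l b : b < 0 -> 0 < hfun d l.+1 b -> 0 < odd_value d l b.
Proof. by move=> b0 h0; rewrite /odd_value divr_gt0//; lra. Qed.

Lemma even_value_gt0 d l (ab : R * R) : 0 < hardy_const R l d ->
  0 < hardy_const R l.+1 d -> admissible d l.+2 ab -> 0 < even_value d l ab.
Proof.
move=> C0 C1 adm; have := even_denominator C0 C1 adm.
case/admissibleE: adm => a0 b0 r0 h0 D.
rewrite /even_value; apply: divr_gt0; first by rewrite !mulr_gt0.
by apply: lt_le_trans D; rewrite mulr_gt0 ?oppr_gt0// divr_gt0.
Qed.

Lemma hardy_const1_gt0 d : (2 < d)%N -> 0 < hardy_const R 1 d.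
Proof.
move=> d2; rewrite hardy_const1E; last by lia.
rewrite mulr_gt0// exprn_even_gt0//= subr_eq0 eq_sym.
rewrite lt_eqF// -[ltLHS]sqrtr1.
by rewrite ltr_sqrt ?divr_gt0 ?ltr0n ?ltr_pdivlMr ?mul1r ?ltr_nat//; lia.
Qed.

Lemma hardy_const_gt0 l d : (2 * l < d)%N -> 0 < hardy_const R l d.
Proof.
suff : ((2 * l < d)%N -> 0 < hardy_const R l d) /\
       ((2 * l.+1 < d)%N -> 0 < hardy_const R l.+1 d) by case.
elim: l => [|l [ih0 ih1]].
  by split=> // d2; apply: hardy_const1_gt0; lia.
split=> // ld.
have C0 : 0 < hardy_const R l d by apply: ih0; lia.
have C1 : 0 < hardy_const R l.+1 d by apply: ih1; lia.
have [ab adm] := admissible_neq0 ld; have /admissibleE[_ b0 _ h0] := adm.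
have [ol|ol] := boolP (odd l).
  rewrite hardy_const_odd// mulr_gt0// ?mulr_gt0//.
  apply: lt_le_trans (odd_value_gt0 b0 h0) _.
  by apply: ub_le_sup; [case: (has_sup_odd ld) | exists ab].
rewrite hardy_const_even//; apply: lt_le_trans (even_value_gt0 C0 C1 adm) _.
by apply: ub_le_sup; [case: (has_sup_even ld C0 C1) | exists ab].
Qed.

Lemma hardy_constS_le l d : (2 * l.+1 < d)%N ->
  hardy_const R l.+1 d <= 2 * d%:R * hardy_const R l d.
Proof.
case: l => [|l] ld.
  rewrite /= mulr1 ger_pMr ?mulr_gt0// ?ltr0n; last by lia.
  have q : 0 <= (Num.sqrt 2 / Num.sqrt d%:R : R) <= 1.
    rewrite divr_ge0 ?sqrtr_ge0//= ler_pdivrMr ?sqrtr_gt0 ?ltr0n; last by lia.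
    by rewrite mul1r ler_wsqrtr// ler_nat; lia.
  by move: q; move: (Num.sqrt 2 / Num.sqrt d%:R) => q /andP[q0 q1]; nra.
have C0 : 0 < hardy_const R l d by apply: hardy_const_gt0; lia.
have C1 : 0 < hardy_const R l.+1 d by apply: hardy_const_gt0; lia.
have [ol|ol] := boolP (odd l).
  rewrite hardy_const_odd//.
  have -> : 2 * d%:R * hardy_const R l.+1 d = 4 * hardy_const R l.+1 d * (d%:R / 2).
    by field.
  rewrite ler_pM2l ?mulr_gt0//; apply: ge_sup; first by case: (has_sup_odd ld).
  by move=> _ [ab /admissibleE[_ b0 _ _] <-]; exact: odd_value_le.
rewrite hardy_const_even//; apply: ge_sup; first by case: (has_sup_even ld C0 C1).
by move=> _ [ab adm <-]; exact: even_value_le.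
Qed.

(** For even l the first fraction of the denominator is compared with the second
    one by means of C^(l+1) <= 2 d C^l and r_l(-1) >= d/4; the term 2 (l + 2) is
    the outcome, and it is crude but bounded in d. *)
Lemma hardy_constSS_ge l d b : (2 * (l.+2 + l.+2) < d)%N -> 0 < b ->
  0 < hfun d l.+1 (- b) ->
  hardy_const R l.+1 d * (4 * hfun d l.+1 (- b) / (b + 2 * l.+2%:R)) <=
  hardy_const R l.+2 d.
Proof.
move=> ld b0 h0; have ld' : (2 * l.+2 < d)%N by lia.
have C0 : 0 < hardy_const R l d by apply: hardy_const_gt0; lia.
have C1 : 0 < hardy_const R l.+1 d by apply: hardy_const_gt0; lia.
have : hardy_const R l.+1 d <= 2 * d%:R * hardy_const R l d.
  by apply: hardy_constS_le; lia.
have b0' : - b < 0 by rewrite oppr_lt0.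
have adm := admissible_m1 ld' b0' h0.
set h := hfun _ _ _ in h0 * => CC.
have l0 : 0 <= l%:R :> R by [].
have [ol|ol] := boolP (odd l).
  rewrite hardy_const_odd// [4 * hardy_const _ _ _]mulrC -!mulrA ler_pM2l//.
  rewrite ler_pM2l//.
  have : odd_value d l (- b) <=
      sup [set odd_value d l ab.2 | ab in @admissible R d l.+2].
    by apply: ub_le_sup; [case: (has_sup_odd ld') | exists (-1, - b)].
  apply: le_trans; rewrite /odd_value opprK -/h ler_pM2l//.
  by rewrite lef_pV2 ?posrE -?[l.+2%:R]natr1 -?[l.+1%:R]natr1; lra.
rewrite hardy_const_even//.
have : even_value d l (-1, - b) <=
    sup [set even_value d l ab | ab in @admissible R d l.+2].
  by apply: ub_le_sup; [case: (has_sup_even ld' C0 C1) | exists (-1, - b)].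
apply: le_trans; rewrite /even_value/= -/h.
set r := rfun _ _ _; set C := hardy_const R l.+1 d in C1 CC *.
have gap : (d%:R - 2 * l%:R - 4) / 2 <= r by apply: rfun_m1_ge; lia.
have d0 : 0 < d%:R :> R by rewrite ltr0n; lia.
have dl : 2 * l%:R + 4 <= d%:R / 2 :> R.
  have : (2 * (l.+2 + l.+2))%:R <= d%:R :> R by rewrite ler_nat; lia.
  by rewrite natrM natrD -[l.+2%:R]natr1 -[l.+1%:R]natr1 => ?; lra.
have r0 : d%:R / 4 <= r by lra.
have rp : 0 < r by apply: lt_le_trans r0; rewrite divr_gt0.
rewrite mulNr !opprK (_ : 1 + l.+2%:R - 1 = l.+2%:R :> R); last by lra.
set D := _ + _ * (r / C).
have l2 : 0 < l.+2%:R :> R by rewrite ltr0n.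
have D0 : 0 < D by rewrite addr_gt0 ?mulr_gt0 ?invr_gt0// ?mulr_gt0.
have DC : D <= r / C * (b + 2 * l.+2%:R).
  rewrite /D mulrDr [r / C * b]mulrC [X in X <= _]addrC lerD2l.
  rewrite ler_pdivrMr ?mulr_gt0//.
  have -> : r / C * (2 * l.+2%:R) * (4 * hardy_const R l d) =
     l.+2%:R * (4 * r * (2 * hardy_const R l d) / C) by field; rewrite gt_eqF.
  rewrite ler_pMr// ler_pdivlMr// mul1r (le_trans CC)// mulrAC [4 * r * _]mulrC.
  by rewrite ler_pM2l ?mulr_gt0//; lra.
have : 0 < b + 2 * l.+2%:R by rewrite addr_gt0 ?mulr_gt0.
move: DC; move: (b + _) => q DC q0.
have -> : C * (4 * h / q) = 4 * r * h / (r / C * q) by field; rewrite !gt_eqF.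
by rewrite ler_pM2l ?mulr_gt0// lef_pV2 ?posrE// !mulr_gt0// invr_gt0.
Qed.

End Constants.

(** * Torus inequalities with the recursive constants, and their growth *)

Section ConstantsHardyLimit.
Variable R : realType.
Implicit Types (l d k : nat) (a b : R).

(** One application of [torus_hardy_step] to Parseval's identity, at the value of b
    that is optimal for l = 1. *)
Lemma torus_hardy_const1 d : (2 < d)%N -> torus_hardy d 1 (hardy_const R 1 d).
Proof.
move=> d2; rewrite hardy_const1E; last by lia.
set y := Num.sqrt _.
have y2 : d%:R = 2 * y ^+ 2 by rewrite sqr_sqrtr ?divr_ge0// mulrC divfK.
have y1 : 1 < y.
  by rewrite -[ltLHS]sqrtr1 ltr_sqrt ?divr_gt0 ?ltr0n ?ltr_pdivlMr ?mul1r ?ltr_nat//; lia.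
have hE : hfun d 0 (1 - y) = (y - 1) ^+ 2 * y by rewrite /hfun y2; field.
have := @torus_hardy_step R d 0 1 (1 - y) ltr01 _ (@torus_hardy0 R d).
rewrite hE (_ : 4 * 1 * _ = 4 * (y - 1) ^+ 2).
  by apply; lra.
by field; lra.
Qed.

Lemma torus_hardy_const l d : (2 * l < d)%N -> torus_hardy d l (hardy_const R l d).
Proof.
suff : ((2 * l < d)%N -> torus_hardy d l (hardy_const R l d)) /\
       ((2 * l.+1 < d)%N -> torus_hardy d l.+1 (hardy_const R l.+1 d)) by case.
elim: l => [|l [ih0 ih1]].
  split=> [_|d2]; first exact: torus_hardy0.
  by apply: torus_hardy_const1; lia.
split=> // ld.
have C0 : 0 < hardy_const R l d by apply: hardy_const_gt0; lia.
have C1 : 0 < hardy_const R l.+1 d by apply: hardy_const_gt0; lia.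
have H0 : torus_hardy d l (hardy_const R l d) by apply: ih0; lia.
have H1 : torus_hardy d l.+1 (hardy_const R l.+1 d) by apply: ih1; lia.
have [ol|ol] := boolP (odd l).
  rewrite hardy_const_odd//; apply: torus_hardy_sup.
  - by rewrite mulr_ge0// ltW.
  - exact: has_sup_odd.
  - move=> _ [ab /admissibleE[_ b0 _ _] <-].
    exact: torus_hardy_step.
rewrite hardy_const_even// -[X in torus_hardy _ _ X]mul1r; apply: torus_hardy_sup => //.
  exact: has_sup_even.
move=> _ [ab /admissibleE[a0 b0 r0 _] <-].
by rewrite mul1r; exact: torus_hardy_step2.
Qed.

Lemma cvg_inv_sqrt : (fun d => (Num.sqrt d%:R)^-1 : R) @ \oo --> (0 : R).
Proof.
rewrite (_ : (fun d => _) = Num.sqrt \o (fun d => d%:R^-1 : R)); last first.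
  by apply/funext => d; rewrite /= sqrtrV.
suff : Num.sqrt \o (fun d => d%:R^-1 : R) @ \oo --> (Num.sqrt 0 : R).
  by rewrite sqrtr0.
apply: continuous_cvg; first exact: sqrt_continuous.
have : (fun d => d.+1%:R^-1 : R) @ \oo --> (0 : R) by exact: cvg_harmonic.
by rewrite (@cvg_shiftS _ (fun d => d%:R^-1 : R)).
Qed.

(** The factor of [hardy_constSS_ge] at b = sqrt d, divided by d, as a function of
    s = 1 / sqrt d. *)
Definition step_ratio l (s : R) : R :=
  (2 - (4 * s + (4 * l%:R + 8) * s ^+ 2)) / (1 + 2 * l.+2%:R * s).

(** The bound on d makes h_(l+1)(- sqrt d) positive. *)
Lemma hardy_const_lower l d : ((2 * l + 8) ^ 2 <= d)%N ->
  hardy_const R l.+1 d / d%:R ^+ l.+1 * step_ratio l (Num.sqrt d%:R)^-1 <=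
  hardy_const R l.+2 d / d%:R ^+ l.+2.
Proof.
move=> ld; set b := Num.sqrt d%:R.
have d0 : (0 < d)%N by apply: leq_trans ld; rewrite expn_gt0 addn_gt0 orbT.
have b2 : d%:R = b ^+ 2 :> R by rewrite sqr_sqrtr.
have bl : 2 * l%:R + 8 <= b.
  rewrite -[leLHS]ger0_norm ?addr_ge0 ?mulr_ge0// -sqrtr_sqr ler_wsqrtr//.
  have : ((2 * l + 8) ^ 2)%:R <= d%:R :> R by rewrite ler_nat.
  by rewrite natrX natrD natrM.
have l0 : 0 <= l%:R :> R by [].
have b0 : 0 < b by lra.
have hE : hfun d l.+1 (- b) = b * ((b ^+ 2 - 2 * l%:R - 4) / 2 - b).
  by rewrite /hfun b2 -[l.+1%:R]natr1; field.
have h0 : 0 < hfun d l.+1 (- b) by rewrite hE mulr_gt0//; nra.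
have ld' : (2 * (l.+2 + l.+2) < d)%N by apply: leq_trans ld; rewrite expnS expn1; nia.
have dl : 0 < d%:R ^+ l.+2 :> R by rewrite exprn_gt0// ltr0n.
rewrite ler_pdivlMr//; apply: le_trans (hardy_constSS_ge ld' b0 h0).
rewrite le_eqVlt; apply/orP; left; apply/eqP.
rewrite /step_ratio hE [d%:R ^+ l.+2]exprS -[l.+2%:R]natr1 -[l.+1%:R]natr1 b2.
have bn : b ^+ 2 ^+ l.+1 != 0 by rewrite !expf_neq0// gt_eqF.
move: (b ^+ 2 ^+ l.+1) bn => z z0; field.
by rewrite z0 !gt_eqF//; lra.
Qed.

Lemma cvg_step_ratio l :
  (fun d => step_ratio l (Num.sqrt d%:R)^-1) @ \oo --> (2 : R).
Proof.
suff : step_ratio l (Num.sqrt d%:R)^-1 @[d --> \oo] --> step_ratio l 0.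
  by rewrite /step_ratio expr0n/= !mulr0 !addr0 subr0 divr1.
apply: continuous_cvg; last exact: cvg_inv_sqrt.
rewrite /step_ratio; apply: cvgM.
  apply: cvgB; first exact: cvg_cst.
  apply: cvgD; first by apply: cvgM; [exact: cvg_cst | exact: cvg_id].
  by apply: cvgM; [exact: cvg_cst | exact: exprn_continuous].
apply: cvgV; first by rewrite mulr0 addr0 oner_neq0.
apply: cvgD; first exact: cvg_cst.
by apply: cvgM; [exact: cvg_cst | exact: cvg_id].
Qed.

Lemma cvg_hardy_const l :
  (fun d => hardy_const R l d / d%:R ^+ l) @ \oo --> (2 ^+ l : R).
Proof.
case: l => [|l].
  rewrite (_ : (fun d => _) = cst 1); first exact: cvg_cst.
  by apply/funext => d; rewrite /= divr1.
elim: l => [|l ih].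
  have H : (fun d => 2 * (1 - Num.sqrt 2 * (Num.sqrt d%:R)^-1) ^+ 2 : R) @ \oo -->
      (2 * (1 - Num.sqrt 2 * 0) ^+ 2 : R).
    apply: cvgM; first exact: cvg_cst.
    apply: (@continuous_cvg _ _ _ _ _ _ (fun x : R => x ^+ 2)).
      exact: exprn_continuous.
    apply: cvgB; first exact: cvg_cst.
    by apply: cvgM; [exact: cvg_cst | exact: cvg_inv_sqrt].
  have E : 2 * (1 - Num.sqrt 2 * 0) ^+ 2 = 2 ^+ 1 :> R.
    by rewrite mulr0 subr0 expr1n mulr1.
  rewrite -E; apply: cvg_trans H; apply: near_eq_cvg.
  near=> d; have d0 : d%:R != 0 :> R.
    by rewrite pnatr_eq0 -lt0n; near: d; exact: nbhs_infty_gt.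
  by rewrite /= expr1; move: (Num.sqrt 2 / _) => q; field.
apply: (@squeeze_cvgr _ _ _ _
  (fun d => hardy_const R l.+1 d / d%:R ^+ l.+1 * step_ratio l (Num.sqrt d%:R)^-1)
  (fun d => 2 * (hardy_const R l.+1 d / d%:R ^+ l.+1))).
- near=> d; rewrite hardy_const_lower ?andTb; last by near: d; exact: nbhs_infty_ge.
  have d0 : 0 < d%:R :> R by rewrite ltr0n; near: d; exact: nbhs_infty_gt.
  rewrite ler_pdivrMr ?exprn_gt0//.
  have -> : 2 * (hardy_const R l.+1 d / d%:R ^+ l.+1) * d%:R ^+ l.+2 =
      2 * d%:R * hardy_const R l.+1 d.
    have : d%:R ^+ l.+1 != 0 :> R by rewrite expf_neq0// gt_eqF.
    rewrite [d%:R ^+ l.+2]exprS; move: (hardy_const _ _ _) (d%:R ^+ l.+1) => C z z0.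
    by field.
  by apply: hardy_constS_le; near: d; exact: nbhs_infty_gt.
- by rewrite exprSr; apply: cvgM ih (cvg_step_ratio l).
- by rewrite exprS; apply: cvgM; [exact: cvg_cst | exact: ih].
Unshelve. all: by end_near. Qed.

End ConstantsHardyLimit.

(** * Back to the lattice: real functions *)

Section Lattice.
Variables (R : realType) (d : nat).
Implicit Types (x : 'rV[R]_d) (n m v : 'rV[int]_d) (i j : 'I_d).
Implicit Types (s : seq 'rV[int]_d) (a b : 'rV[int]_d -> R) (t : R).

Local Notation "''e_' j" := (stdbasis j) (at level 8, j at level 2).

Definition rlap a n : R := \sum_j (a n *+ 2 - a (n - 'e_j) - a (n + 'e_j)).

(** The square of [norm_half_lap] for a real function. *)
Definition renergy (l : nat) a n : R :=
  let v := iter l./2 rlap a in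
  if odd l then \sum_j (v n - v (n - 'e_j)) ^+ 2 else v n ^+ 2.

Definition supported a s := forall n, n \notin s -> a n = 0.

(** The set of points at distance at most 1 from s. It bounds the supports of
    difference operators, so that all sums run over one finite list. *)
Definition grow s : seq 'rV[int]_d :=
  undup (s ++ [seq n + 'e_j | n <- s, j <- enum 'I_d] ++
         [seq n - 'e_j | n <- s, j <- enum 'I_d]).

Lemma grow_sub s : {subset s <= grow s}.
Proof. by move=> n ns; rewrite mem_undup mem_cat ns. Qed.

Lemma grow_add s n j : n \in s -> n + 'e_j \in grow s.
Proof.
move=> ns; rewrite mem_undup !mem_cat; apply/orP; right; apply/orP; left.
by apply/allpairsP; exists (n, j); rewrite mem_enum.
Qed.

Lemma grow_sub_basis s n j : n \in s -> n - 'e_j \in grow s.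
Proof.
move=> ns; rewrite mem_undup !mem_cat; apply/orP; right; apply/orP; right.
by apply/allpairsP; exists (n, j); rewrite mem_enum.
Qed.

Lemma supported_sub a s s' : {subset s <= s'} -> supported a s -> supported a s'.
Proof. by move=> ss as_ n ns; apply: as_; apply: contra ns => /ss. Qed.

Lemma supported_shift a s j : supported a s ->
  supported (fun n => a (n - 'e_j)) (grow s) /\
  supported (fun n => a (n + 'e_j)) (grow s).
Proof.
move=> as_; split=> n ns; apply: as_; apply: contra ns.
  by move=> /(grow_add j); rewrite subrK.
by move=> /(grow_sub_basis j); rewrite addrK.
Qed.

Lemma supported_rlap a s : supported a s -> supported (rlap a) (grow s).
Proof.
move=> as_ n ns; have a0 := supported_sub (@grow_sub s) as_ ns.
rewrite /rlap big1// => j _; have [am ap] := supported_shift j as_.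
by rewrite am// ap// a0 mul0rn !subr0.
Qed.

Lemma supported_iter k a s : supported a s ->
  supported (iter k rlap a) (iter k grow s).
Proof. by move=> as_; elim: k => //= k ihk; exact: supported_rlap. Qed.

Lemma iter_grow_sub k k' s : (k <= k')%N ->
  {subset iter k grow s <= iter k' grow s}.
Proof.
move=> /subnK <-; elim: (k' - k)%N => // p ihp n ns.
by rewrite addSn /=; apply/grow_sub/ihp.
Qed.

Lemma fsbig_supported (F : 'rV[int]_d -> R) s : uniq s -> supported F s ->
  \sum_(n \in [set: 'rV[int]_d]) F n = \sum_(n <- s) F n.
Proof.
move=> us Fs; rewrite [RHS]fsbig_seq//; apply/esym; apply: fsbig_widen => // n [_ /= ns].
by apply: Fs; apply/negP.
Qed.

Lemma sum_supported (F : 'rV[int]_d -> R) s s' : uniq s -> uniq s' ->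
  supported F s -> supported F s' -> \sum_(n <- s) F n = \sum_(n <- s') F n.
Proof. by move=> us us' Fs Fs'; rewrite -!fsbig_supported. Qed.

Lemma dotD n m x : dot (n + m) x = dot n x + dot m x.
Proof.
rewrite /dot -big_split/=; apply: eq_bigr => j _.
by rewrite mxE rmorphD mulrDl.
Qed.

Lemma dotN n x : dot (- n) x = - dot n x.
Proof.
by rewrite /dot -sumrN; apply: eq_bigr => j _; rewrite mxE rmorphN mulNr.
Qed.

Lemma dot_basis j x : dot ('e_j) x = x 0 j.
Proof.
rewrite /dot (bigD1 j)//= /stdbasis mxE !eqxx mul1r big1 ?addr0// => i ij.
by rewrite mxE (negPf ij) mul0r.
Qed.

Lemma wave_shift s a v t x : uniq s -> supported a s ->
  supported (fun n => a (n - v)) s ->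
  wave s (fun n => a (n - v)) t x = wave s a (t + dot v x) x.
Proof.
move=> us as_ avs; rewrite /wave.
have -> : \sum_(n <- s) a (n - v) * cos (dot n x + t) =
    \sum_(m <- [seq n - v | n <- s]) a m * cos (dot m x + (t + dot v x)).
  rewrite big_map; apply: eq_bigr => n _; rewrite dotD dotN; congr (_ * cos _).
  by ring.
apply: sum_supported => // [|n ns|n ns].
- by rewrite map_inj_uniq// => n m /addIr.
- suff -> : a n = 0 by rewrite mul0r.
  rewrite -(addrK v n); apply: avs; apply: contra ns => ns.
  by apply/mapP; exists (n + v); rewrite ?addrK.
- by rewrite as_// mul0r.
Qed.

Lemma wave_phase s a t u x :
  wave s a (t + u) x = cos u * wave s a t x + sin u * wave s a (t + pi / 2) x.
Proof.
rewrite /wave !mulr_sumr -big_split; apply: eq_bigr => n _ /=.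
by rewrite !addrA cosDpihalf (cosD (dot n x + t) u); ring.
Qed.

Lemma wave_pi s a t x : wave s a (t + pi / 2 + pi / 2) x = - wave s a t x.
Proof.
rewrite /wave -sumrN; apply: eq_bigr => n _.
by rewrite !addrA cosDpihalf sinDpihalf mulrN.
Qed.

Lemma wave_grad s s' a j t x : uniq s -> {subset grow s' <= s} -> supported a s' ->
  wave s (fun n => a n - a (n - 'e_j)) t x = wave s a t x - wave s a (t + x 0 j) x.
Proof.
move=> us ss as_; have [am _] := supported_shift j as_.
have as' : supported a s by apply: supported_sub as_ => n /(@grow_sub s') /ss.
rewrite -dot_basis -wave_shift//; last exact: supported_sub am.
by rewrite /wave -sumrB; apply: eq_bigr => n _; rewrite mulrBl.
Qed.

(** |1 - e^(i x_j)|^2 = 2 - 2 cos x_j: the differences of a correspond to the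
    multiplication by the symbol, which accounts for odd powers of Delta^(1/2). *)
Lemma wave_sqr_grad s s' a t x : uniq s -> {subset grow s' <= s} -> supported a s' ->
  \sum_j wave_sqr s (fun n => a n - a (n - 'e_j)) t x = symb 0 x * wave_sqr s a t x.
Proof.
move=> us ss as_; rewrite /symb add0r mulr_suml; apply: eq_bigr => j _.
rewrite /wave_sqr !(wave_grad j _ _ us ss as_) ![wave s a (_ + x 0 j) x]wave_phase.
rewrite wave_pi; have := cos2Dsin2 (x 0 j).
move: (cos _) (sin _) (wave _ _ _ _) (wave _ _ _ _) => c z A B cz.
rewrite (_ : 2 - 2 * c = (1 - c) ^+ 2 + z ^+ 2); first by ring.
have -> : z ^+ 2 = 1 - c ^+ 2 by rewrite -cz addrC addKr.
by ring.
Qed.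

Lemma wave_rlap s s' a t x : uniq s -> {subset grow s' <= s} -> supported a s' ->
  wave s (rlap a) t x = symb 0 x * wave s a t x.
Proof.
move=> us ss as_.
have as' : supported a s by apply: supported_sub as_ => n /(@grow_sub s') /ss.
rewrite /symb add0r mulr_suml.
transitivity (\sum_j (wave s a t x *+ 2 - wave s a (t + x 0 j) x
                      - wave s a (t - x 0 j) x)).
  have sm j := wave_shift t x us as' (supported_sub ss (supported_shift j as_).1).
  have sp j : wave s (fun n => a (n + 'e_j)) t x = wave s a (t - x 0 j) x.
    rewrite -dot_basis -dotN -wave_shift//; rewrite ?opprK//.
    exact: supported_sub ss (supported_shift j as_).2.
  have E j : wave s a t x *+ 2 - wave s a (t + x 0 j) x - wave s a (t - x 0 j) x =
      \sum_(n <- s) (a n *+ 2 - a (n - 'e_j) - a (n + 'e_j)) * cos (dot n x + t).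
    rewrite -sp -(dot_basis j x) -sm /wave.
    rewrite -sumrMnl -!sumrB; apply: eq_bigr => n _.
    by rewrite !mulrBl mulrnAl.
  transitivity (\sum_j \sum_(n <- s)
      (a n *+ 2 - a (n - 'e_j) - a (n + 'e_j)) * cos (dot n x + t)).
    rewrite exchange_big/= /wave; apply: eq_bigr => n _.
    by rewrite /rlap mulr_suml.
  by apply: eq_bigr => j _; rewrite E.
apply: eq_bigr => j _; rewrite (wave_phase s a t (x 0 j)).
by rewrite (wave_phase s a t (- x 0 j)) cosN sinN; ring.
Qed.

Lemma iter_rlap_wave s s' k a t x : uniq s ->
  {subset iter k grow s' <= s} -> supported a s' ->
  wave s (iter k rlap a) t x = symb 0 x ^+ k * wave s a t x.
Proof.
move=> us + as_; elim: k => [|k ihk] ss; first by rewrite mul1r.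
rewrite iterS (wave_rlap _ _ us ss (@supported_iter k _ _ as_)) ihk ?exprS ?mulrA//.
by move=> n /(@grow_sub _)/ss.
Qed.

(** Half of the powers of the symbol act on each factor of the square; an odd one
    is left over for the gradient. *)
Lemma parseval_energy l s s' a t : uniq s ->
  {subset iter l./2.+1 grow s' <= s} -> supported a s' ->
  mean_le (fun x => symb 0 x ^+ l * wave_sqr s a t x)
          (fun=> \sum_(n <- s) renergy l a n).
Proof.
move=> us ss as_; set k := l./2; set v := iter k rlap a.
have vs : supported v (iter k grow s') := @supported_iter k _ _ as_.
have ss' : {subset iter k grow s' <= s} by move=> n /(@grow_sub _)/ss.
have vw u x : wave s v u x = symb 0 x ^+ k * wave s a u x.
  exact: iter_rlap_wave us ss' as_.
have vp x : symb 0 x ^+ (k + k) * wave_sqr s a t x = wave_sqr s v t x.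
  by rewrite /wave_sqr !vw exprD; ring.
have PE (b : 'rV[int]_d -> R) :
    mean_le (fun x => wave_sqr s b t x) (fun=> \sum_(n <- s) b n ^+ 2).
  exact: parseval_le.
rewrite /renergy -/k -/v; have := odd_double_half l; rewrite -/k -addnn.
case: (odd l) => <-.
  have := mean_le_sum (index_enum 'I_d) (fun j => PE (fun n => v n - v (n - 'e_j))).
  move/mean_le_shift; apply => x.
  rewrite exchange_big (wave_sqr_grad _ _ us ss vs) exprD expr1 -mulrA vp.
  exact: lexx.
by move: (PE v); congr mean_le; apply/funext => x; rewrite vp.
Qed.

(** Replacing the symbol w by w + e changes its powers by O(e) uniformly. *)
Lemma expr_perturb (l : nat) (X : R) : 0 <= X -> exists2 K, 0 <= K &
  forall z e, 0 <= z <= X -> 0 <= e <= 1 -> (z + e) ^+ l <= z ^+ l + e * K.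
Proof.
move=> X0; elim: l => [|l [K K0 ihl]].
  by exists 0 => // z e _ _; rewrite !expr0 mulr0 addr0.
exists (X ^+ l + X * K + K); first by rewrite !addr_ge0// ?mulr_ge0// exprn_ge0.
move=> z e zX e01; have := ihl z e zX e01; move: zX e01 => /andP[z0 zX] /andP[e0 e1] ih.
rewrite !exprS; apply: (@le_trans _ _ ((z + e) * (z ^+ l + e * K))).
  by rewrite ler_wpM2l// addr_ge0.
have zl : z ^+ l <= X ^+ l by rewrite lerXn2r ?nnegrE.
rewrite -subr_ge0.
have -> : z * z ^+ l + e * (X ^+ l + X * K + K) - (z + e) * (z ^+ l + e * K) =
   e * (X ^+ l - z ^+ l) + e * K * (X - z) + e * K * (1 - e) by ring.
have eK : 0 <= e * K by rewrite mulr_ge0.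
by do ?apply: addr_ge0; apply: mulr_ge0; rewrite ?subr_ge0.
Qed.

Lemma symb0_bound x : 0 <= symb (0 : R) x <= 4 * d%:R.
Proof.
rewrite symb_ge/= /symb add0r.
rewrite (_ : 4 * d%:R = \sum_(j < d) 4); last by rewrite sumr_const card_ord mulr_natr.
by apply: ler_sum => j _; have := cos_geN1 (x 0 j) => ?; lra.
Qed.

Lemma symbE (e : R) x : symb e x = symb 0 x + e.
Proof. by rewrite /symb add0r addrC. Qed.

(** Duality: the torus inequality for psi = a / |n|^(2l) and the arithmetic-geometric
    mean inequality with factor C, then e to 0. At n = 0 both a and psi vanish,
    which makes the default value of the division harmless. *)
Lemma real_lattice_hardy l s s' a : (2 * l < d)%N -> uniq s ->
  {subset iter l./2.+1 grow s' <= s} -> supported a s' -> a 0 = 0 ->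
  hardy_const R l d * (\sum_(n <- s) a n ^+ 2 / nsq R n ^+ l) <=
  \sum_(n <- s) renergy l a n.
Proof.
move=> ld us ss as_ a0; set C := hardy_const R l d.
have C0 : 0 < C := hardy_const_gt0 R ld.
pose psi n := a n / nsq R n ^+ l.
set S := \sum_(n <- s) _; set E := \sum_(n <- s) _.
have psi0 : psi 0 = 0 by rewrite /psi a0 mul0r.
have S1 : S = \sum_(n <- s) a n * psi n.
  by apply: eq_bigr => n _; rewrite /psi mulrA.
have S2 : S = \sum_(n <- s) nsq R n ^+ l * psi n ^+ 2.
  apply: eq_bigr => n _; have [->|n0] := eqVneq n 0.
    by rewrite a0 psi0 expr0n/= mul0r mulr0.
  have : nsq R n ^+ l != 0 by rewrite expf_neq0// nsq_eq0.
  by rewrite /psi; move: (nsq _ _ ^+ _) => z z0; field.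
have [K K0 HK] := @expr_perturb l (4 * d%:R) (mulr_ge0 (ler0n _ _) (ler0n _ _)).
pose B := 2 * (\sum_(n <- s) `|a n|) ^+ 2.
have B0 : 0 <= B by rewrite mulr_ge0// sqr_ge0.
suff CS e : 0 < e <= 1 -> C * S <= E + e * (K * B).
  apply/ler_addgt0Pr => e e0.
  have KB : 0 < K * B + 1 by rewrite ltr_wpDl// mulr_ge0.
  have e'0 : 0 < Num.min 1 (e / (K * B + 1)) <= 1.
    by rewrite lt_min ltr01 divr_gt0//= ge_min lexx.
  apply: le_trans (CS _ e'0) _; rewrite lerD2l.
  apply: (@le_trans _ _ (e / (K * B + 1) * (K * B))).
    by apply: ler_wpM2r; [exact: mulr_ge0 | rewrite ge_min lexx orbT].
  by rewrite mulrAC ler_pdivrMr// ler_pM2l//; lra.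
move=> /andP[e0 e1].
have P := parseval_ge a psi 0 us.
have T := torus_hardy_const ld 0 e0 us psi0.
rewrite -/C -S2 in T; rewrite -S1 in P.
have En := parseval_energy 0 us ss as_; rewrite -/E in En.
have C20 : 0 <= 2 * C by rewrite mulr_ge0// ltW.
have N := mean_leD (mean_leZ C20 P) (mean_leD En (mean_leZ (ltW C0) T)).
suff : mean_le (fun=> C * S : R) (fun _ : 'rV[R]_d => E + e * (K * B)).
  exact: mean_le_cst.
apply: (mean_le_shift N) => x.
have W0 := symb_gt0 e0 x.
set V := (symb e x)^-1.
have V0 : 0 <= V ^+ l by rewrite exprn_ge0// invr_ge0 ltW.
have Wl0 : 0 <= symb e x ^+ l by rewrite exprn_ge0// ltW.
have VW : V ^+ l * symb e x ^+ l = 1 by rewrite -exprMn mulVf ?expr1n ?gt_eqF.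
have amgm (p q : R) :
    2 * C * (p * q) <= symb e x ^+ l * p ^+ 2 + C ^+ 2 * (V ^+ l * q ^+ 2).
  rewrite -subr_ge0.
  have -> : symb e x ^+ l * p ^+ 2 + C ^+ 2 * (V ^+ l * q ^+ 2) - 2 * C * (p * q) =
     symb e x ^+ l * (p - C * V ^+ l * q) ^+ 2 +
     (1 - V ^+ l * symb e x ^+ l) * (C ^+ 2 * (V ^+ l * q ^+ 2) - 2 * C * (p * q)).
    by ring.
  by rewrite VW subrr mul0r addr0 mulr_ge0// sqr_ge0.
have A1 := amgm (wave s a 0 x) (wave s psi 0 x).
have A2 := amgm (wave s a (0 + pi / 2) x) (wave s psi (0 + pi / 2) x).
have pw :
    symb e x ^+ l * wave_sqr s a 0 x <= symb 0 x ^+ l * wave_sqr s a 0 x + e * (K * B).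
  apply: (@le_trans _ _ ((symb 0 x ^+ l + e * K) * wave_sqr s a 0 x)).
    rewrite ler_wpM2r ?wave_sqr_ge0// symbE HK// ?symb0_bound//.
    by rewrite (ltW e0).
  rewrite mulrDl lerD2l -mulrA ler_wpM2l ?(ltW e0)// ler_wpM2l//.
  exact: wave_sqr_bound.
move: A1 A2 pw; rewrite /wave_sqr => A1 A2 pw.
rewrite -[C ^+ 2]/(C * C) in A1 A2.
by lra.
Qed.

End Lattice.

(** * Complex functions *)

Section ComplexSplitting.
Variables (R : realType) (d : nat).
Implicit Types (n : 'rV[int]_d) (u : 'rV[int]_d -> R[i]).

Lemma normc_sqr (z : R[i]) : Normc.normc z ^+ 2 = complex.Re z ^+ 2 + complex.Im z ^+ 2.
Proof. by case: z => a b /=; rewrite sqr_sqrtr// addr_ge0// sqr_ge0. Qed.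

Lemma ReB (z w : R[i]) : complex.Re (z - w) = complex.Re z - complex.Re w.
Proof. by case: z w => [? ?] []. Qed.

Lemma ImB (z w : R[i]) : complex.Im (z - w) = complex.Im z - complex.Im w.
Proof. by case: z w => [? ?] []. Qed.

Lemma Re_dlaplacian u n :
  complex.Re (dlaplacian u n) = rlap (fun m => complex.Re (u m)) n.
Proof.
rewrite /dlaplacian (big_morph (@complex.Re R) (id1 := 0) (op1 := +%R)) //.
  apply: eq_bigr => j _; rewrite !ReB; congr (_ - _ - _).
  by case: (u n) => a b; rewrite !mulr2n.
by case=> [? ?] [].
Qed.

Lemma Im_dlaplacian u n :
  complex.Im (dlaplacian u n) = rlap (fun m => complex.Im (u m)) n.
Proof.
rewrite /dlaplacian (big_morph (@complex.Im R) (id1 := 0) (op1 := +%R)) //.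
  apply: eq_bigr => j _; rewrite !ImB; congr (_ - _ - _).
  by case: (u n) => a b; rewrite !mulr2n.
by case=> [? ?] [].
Qed.

(** The operators have real coefficients, so real and imaginary parts decouple. *)
Lemma norm_half_lap_sqr l u n : norm_half_lap l u n ^+ 2 =
  renergy l (fun m => complex.Re (u m)) n + renergy l (fun m => complex.Im (u m)) n.
Proof.
have ReI k m : complex.Re (iter k (@dlaplacian R d) u m) =
    iter k (@rlap R d) (fun m => complex.Re (u m)) m.
  elim: k m => // k ihk m; rewrite !iterS Re_dlaplacian.
  by congr (rlap _ m); apply/funext.
have ImI k m : complex.Im (iter k (@dlaplacian R d) u m) =
    iter k (@rlap R d) (fun m => complex.Im (u m)) m.
  elim: k m => // k ihk m; rewrite !iterS Im_dlaplacian.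
  by congr (rlap _ m); apply/funext.
rewrite /norm_half_lap /renergy; case: ifP => _; last by rewrite normc_sqr ReI ImI.
rewrite /cnorm sqr_sqrtr; last by apply: sumr_ge0 => j _; exact: sqr_ge0.
rewrite -big_split/=; apply: eq_bigr => j _.
by rewrite mxE normc_sqr ReB ImB !ReI !ImI.
Qed.

Lemma znorm_exp l n : znorm R n ^+ (2 * l) = nsq R n ^+ l.
Proof. by rewrite exprM sqr_sqrtr// nsq_ge0. Qed.

Lemma supported_energy l (a : 'rV[int]_d -> R) s : supported a s ->
  supported (renergy l a) (iter l./2.+1 (@grow d) s).
Proof.
move=> as_ n ns; set k := l./2.
have vs : supported (iter k (@rlap R d) a) (iter k (@grow d) s) := supported_iter as_.
have v0 := supported_sub (@grow_sub d (iter k (@grow d) s)) vs ns.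
rewrite /renergy -/k; case: ifP => _; last by rewrite v0 expr0n.
rewrite big1// => j _; rewrite v0.
by rewrite (supported_shift j vs).1// subrr expr0n.
Qed.

Lemma lattice_hardy l u : (2 * l < d)%N -> finite_set [set n | u n != 0] -> u 0 = 0 ->
  hardy_const R l d *
    \sum_(n \in [set: 'rV[int]_d]) Normc.normc (u n) ^+ 2 / znorm R n ^+ (2 * l) <=
  \sum_(n \in [set: 'rV[int]_d]) norm_half_lap l u n ^+ 2.
Proof.
move=> ld fu u0.
pose s' : seq 'rV[int]_d := finmap.enum_fset (fset_set [set n | u n != 0]).
have us' : forall n, n \notin s' -> u n = 0.
  move=> n; rewrite (in_fset_set fu n) => /negP ns; apply/eqP; apply/negPn/negP => un.
  by apply: ns; rewrite inE.
pose s := iter l./2.+1 (@grow d) s'.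
have us : uniq s by exact: undup_uniq.
have s's : {subset s' <= s} := @iter_grow_sub d 0 l./2.+1 s' isT.
have re_s : supported (fun n => complex.Re (u n)) s' by move=> n /us' ->.
have im_s : supported (fun n => complex.Im (u n)) s' by move=> n /us' ->.
have re0 : complex.Re (u 0) = 0 by rewrite u0.
have im0 : complex.Im (u 0) = 0 by rewrite u0.
have sub : {subset iter l./2.+1 (@grow d) s' <= s} by [].
have HR := real_lattice_hardy ld us sub re_s re0.
have HI := real_lattice_hardy ld us sub im_s im0.
rewrite (fsbig_supported us); last first.
  move=> n ns; rewrite us' ?normc_sqr/= ?expr0n/= ?addr0 ?mul0r//.
  by apply: contra ns => /s's.
rewrite (fsbig_supported us); last first.
  move=> n ns; rewrite norm_half_lap_sqr.
  by rewrite (supported_energy re_s ns) (supported_energy im_s ns) addr0.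
under eq_bigr do rewrite normc_sqr znorm_exp mulrDl.
under [X in _ <= X]eq_bigr do rewrite norm_half_lap_sqr.
by rewrite !big_split mulrDr; exact: lerD.
Qed.

End ComplexSplitting.

Theorem theorem17 (R : realType) (l : nat) (hl : (0 < l)%N) :
  (forall d : nat, (2 * l < d)%N ->
     forall u : 'rV[int]_d -> R[i],
       finite_set [set n | u n != 0] ->
       u 0 = 0 ->
       \sum_(n \in [set: 'rV[int]_d]) norm_half_lap l u n ^+ 2 >=
       hardy_const R l d *
       \sum_(n \in [set: 'rV[int]_d])
          Normc.normc (u n) ^+ 2 / znorm R n ^+ (2 * l))
  /\
  (fun d : nat => hardy_const R l d / d%:R ^+ l) @ \oo --> (2 ^+ l : R).
Proof.
split; last exact: cvg_hardy_const.
by move=> d ld u fu u0; exact: lattice_hardy.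
Qed.
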